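(* Let $\Gamma$ be a graph with no induced squares, and let $\Delta\leq \Gamma^{\mathrm{ext}}_k$ be a finite induced subgraph whose vertices correspond to pairwise disjoint cliques of $\Gamma^{\mathrm{ext}}$. Then there exists an integer $M>0$ with the following property: for any family $(g_K)_{K\in V(\Delta)}$ of elements of $A(\Gamma)$ such that $\mathrm{supp}(g_K)=P_K$ for all $K\in V(\Delta)$, the map $V(\Delta)\to A(\Gamma)$, $K\mapsto g_K^{M}$, extends to an injective group homomorphism $A(\Delta)\hookrightarrow A(\Gamma)$.
   Context: All graphs are simplicial (unoriented, no loops, no multi-edges), possibly infinite. An induced square is an induced cycle of length 4. $\Delta\le\Theta$ means that $\Delta$ is (embedded as) an induced subgraph of $\Theta$. The right-angled Artin group $A(\Gamma)$ has generating set $V(\Gamma)$ (standard generators), whose only relations are that adjacent vertices commute. For $\Theta\leq\Gamma$, $A(\Theta)$ is identified with the subgroup of $A(\Gamma)$ generated by $V(\Theta)$; a parabolic subgroup of $A(\Gamma)$ is a conjugate of some $A(\Theta)$ with $\Theta\le\Gamma$. For $g\in A(\Gamma)$, $\mathrm{supp}(g)$ is the smallest parabolic subgroup of $A(\Gamma)$ containing $g$. The extension graph $\Gamma^{\mathrm{ext}}$ has vertex set $\{gvg^{-1}\mid g\in A(\Gamma),v\in V(\Gamma)\}$, two vertices being adjacent iff they are distinct commuting elements of $A(\Gamma)$. The clique graph $\Theta_k$ of a graph $\Theta$ has one vertex for each non-empty finite clique of $\Theta$, two distinct cliques being adjacent iff they are contained in a common clique; $\Gamma^{\mathrm{ext}}_k$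 is the clique graph of $\Gamma^{\mathrm{ext}}$. For a vertex $K$ of $\Gamma^{\mathrm{ext}}_k$ (a finite clique of $\Gamma^{\mathrm{ext}}$), $P_K$ denotes the subgroup of $A(\Gamma)$ generated by the vertices of $K$, seen as elements of $A(\Gamma)$; it is an abelian parabolic subgroup. *)

(* Defs.v *)
From HB Require Import structures.
From mathcomp Require Import all_boot finmap generic_quotient.
From mathcomp Require Import boolp classical_sets.

Set Implicit Arguments.
Unset Strict Implicit.
Unset Printing Implicit Defensive.

Local Open Scope quotient_scope.
Local Open Scope classical_set_scope.

(* Adjacency is boolean and vertices form a choiceType; under the classical
   axioms of [boolp] this is no restriction on a graph. *)
Record sgraph : Type := SGraph {
  vertex :> choiceType;
  adj : rel vertex;
  adj_sym : symmetric adj;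
  adj_irrefl : irreflexive adj }.

Definition has_induced_square (G : sgraph) : Prop :=
  exists a b c d : G,
    [/\ uniq [:: a; b; c; d],
        [/\ adj a b, adj b c, adj c d & adj d a],
        ~~ adj a c & ~~ adj b d].

Section InducedSubgraph.
Variables (G : sgraph) (D : {fset G}).

Definition induced_adj : rel D := fun x y => adj (val x) (val y).

Fact induced_adj_sym : symmetric induced_adj.
Proof. by move=> x y; apply: adj_sym. Qed.

Fact induced_adj_irrefl : irreflexive induced_adj.
Proof. by move=> x; apply: adj_irrefl. Qed.

Definition induced_subgraph : sgraph :=
  @SGraph D induced_adj induced_adj_sym induced_adj_irrefl.

End InducedSubgraph.

Definition is_clique (G : sgraph) (C : set G) : Prop :=
  forall x y : G, C x -> C y -> x != y -> adj x y.

Section CliqueGraph.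
Variable G : sgraph.

Definition nonempty_clique : pred {fset G} :=
  fun K => (K != fset0) && `[< is_clique [set` K] >].

Definition clique : choiceType := {K : {fset G} | nonempty_clique K}.

Definition clique_adj : rel clique := fun K L =>
  (K != L) && `[< exists C : set G,
                    [/\ is_clique C, [set` val K] `<=` C & [set` val L] `<=` C] >].

Fact clique_adj_sym : symmetric clique_adj.
Proof.
move=> K L; rewrite /clique_adj eq_sym; congr (_ && _).
by apply/asboolP/asboolP => -[C [? ? ?]]; exists C.
Qed.

Fact clique_adj_irrefl : irreflexive clique_adj.
Proof. by move=> K; rewrite /clique_adj eqxx. Qed.

Definition clique_graph : sgraph :=
  @SGraph clique clique_adj clique_adj_sym clique_adj_irrefl.

End CliqueGraph.

Section RAAG.
Variable G : sgraph.

(* The letter (v, true) stands for v and (v, false) for its inverse. *)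
Definition word : choiceType := seq (G * bool).

(* The congruence on words presenting the group
   < v in V(G) | uv = vu whenever u and v are adjacent >. *)
Inductive word_eq : word -> word -> Prop :=
| word_eq_refl w : word_eq w w
| word_eq_sym w1 w2 : word_eq w1 w2 -> word_eq w2 w1
| word_eq_trans w1 w2 w3 : word_eq w1 w2 -> word_eq w2 w3 -> word_eq w1 w3
| word_eq_cat w1 w1' w2 w2' :
    word_eq w1 w1' -> word_eq w2 w2' -> word_eq (w1 ++ w2) (w1' ++ w2')
| word_eq_cancel v b : word_eq [:: (v, b); (v, ~~ b)] [::]
| word_eq_comm u v : adj u v ->
    word_eq [:: (u, true); (v, true)] [:: (v, true); (u, true)].

Definition word_eqb : rel word := fun w1 w2 => `[< word_eq w1 w2 >].

Fact word_eqb_refl : reflexive word_eqb.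
Proof. by move=> w; apply/asboolP; apply: word_eq_refl. Qed.

Fact word_eqb_sym : symmetric word_eqb.
Proof. by move=> w1 w2; apply/asboolP/asboolP; apply: word_eq_sym. Qed.

Fact word_eqb_trans : transitive word_eqb.
Proof.
move=> w2 w1 w3 /asboolP e12 /asboolP e23; apply/asboolP.
exact: word_eq_trans e12 e23.
Qed.

Canonical word_equiv : equiv_rel word :=
  EquivRel word_eqb word_eqb_refl word_eqb_sym word_eqb_trans.

Definition raag : Type := {eq_quot word_equiv}.

HB.instance Definition _ := Choice.on raag.
HB.instance Definition _ := EqQuotient.on raag.

Lemma raag_eqP (w1 w2 : word) : \pi_raag w1 = \pi_raag w2 <-> word_eq w1 w2.
Proof. by split=> [/eqmodP/asboolP | ?] //; apply/eqmodP/asboolP. Qed.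

Definition word_inv (w : word) : word := [seq (l.1, ~~ l.2) | l <- rev w].

Lemma word_inv_cat w1 w2 : word_inv (w1 ++ w2) = word_inv w2 ++ word_inv w1.
Proof. by rewrite /word_inv rev_cat map_cat. Qed.

Lemma word_invK : involutive word_inv.
Proof.
move=> w; rewrite /word_inv -map_rev revK -map_comp -[RHS]map_id.
by apply: eq_map => -[v b] /=; rewrite negbK.
Qed.

Lemma word_invr w : word_eq (w ++ word_inv w) [::].
Proof.
elim: w => [|[v b] w IHw]; first exact: word_eq_refl.
rewrite -cat1s word_inv_cat -catA (catA w).
apply: (@word_eq_trans _ ([:: (v, b)] ++ ([::] ++ word_inv [:: (v, b)]))).
  apply: word_eq_cat; first exact: word_eq_refl.
  by apply: word_eq_cat IHw _; exact: word_eq_refl.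
exact: word_eq_cancel.
Qed.

Lemma word_invl w : word_eq (word_inv w ++ w) [::].
Proof. by rewrite -{2}(word_invK w); exact: word_invr. Qed.

Lemma word_eq_inv w1 w2 : word_eq w1 w2 -> word_eq (word_inv w1) (word_inv w2).
Proof.
move=> e12.
apply: (@word_eq_trans _ (word_inv w1 ++ (w2 ++ word_inv w2))).
  rewrite -[X in word_eq X _]cats0; apply: word_eq_cat.
    exact: word_eq_refl.
  exact/word_eq_sym/word_invr.
rewrite catA -[X in word_eq _ X]cat0s; apply: word_eq_cat; last first.
  exact: word_eq_refl.
apply: (@word_eq_trans _ (word_inv w1 ++ w1)); last exact: word_invl.
by apply: word_eq_cat; [exact: word_eq_refl | exact: word_eq_sym].
Qed.

Definition raag_one : raag := \pi_raag [::].
Definition raag_mul (x y : raag) : raag := \pi_raag (repr x ++ repr y).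
Definition raag_inv (x : raag) : raag := \pi_raag (word_inv (repr x)).

Lemma raag_reprP w : word_eq (repr (\pi_raag w)) w.
Proof. by apply/raag_eqP; rewrite reprK. Qed.

Lemma raag_mulE w1 w2 :
  raag_mul (\pi_raag w1) (\pi_raag w2) = \pi_raag (w1 ++ w2).
Proof. by apply/raag_eqP; apply: word_eq_cat; apply: raag_reprP. Qed.

Lemma raag_invE w : raag_inv (\pi_raag w) = \pi_raag (word_inv w).
Proof. by apply/raag_eqP; apply: word_eq_inv; apply: raag_reprP. Qed.

Fact raag_mulA : associative raag_mul.
Proof.
move=> x y z; rewrite -[x]reprK -[y]reprK -[z]reprK.
rewrite (raag_mulE (repr y)) (raag_mulE (repr x) (repr y)).
by rewrite !raag_mulE catA.
Qed.

Fact raag_mul1 : left_id raag_one raag_mul.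
Proof. by move=> x; rewrite -[x]reprK raag_mulE. Qed.

Fact raag_mulr1 : right_id raag_one raag_mul.
Proof. by move=> x; rewrite -[x]reprK raag_mulE cats0. Qed.

Fact raag_mulV : left_inverse raag_one raag_inv raag_mul.
Proof.
move=> x; rewrite -[x]reprK raag_invE raag_mulE.
by apply/raag_eqP; apply: word_invl.
Qed.

Fact raag_mulrV : right_inverse raag_one raag_inv raag_mul.
Proof.
move=> x; rewrite -[x]reprK raag_invE raag_mulE.
by apply/raag_eqP; apply: word_invr.
Qed.

HB.instance Definition _ :=
  isGroup.Build raag raag_mulA raag_mul1 raag_mulr1 raag_mulV raag_mulrV.

Definition std_gen (v : G) : raag := \pi_raag [:: (v, true)].

End RAAG.

Local Open Scope group_scope.

Definition is_subgroup (A : groupType) (H : set A) : Prop :=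
  H 1 /\ forall x y : A, H x -> H y -> H (x / y).

Definition generated (A : groupType) (S : set A) : set A :=
  smallest (@is_subgroup A) S.

Definition is_parabolic (G : sgraph) (P : set (raag G)) : Prop :=
  exists (T : set G) (g : raag G),
    P = [set g * x * g^-1 | x in generated (@std_gen G @` T)].

(* Relational form of supp(g) = P, so that the existence of a smallest
   parabolic subgroup containing g is not presupposed. *)
Definition has_supp (G : sgraph) (g : raag G) (P : set (raag G)) : Prop :=
  [/\ is_parabolic P, P g &
      forall Q : set (raag G), is_parabolic Q -> Q g -> P `<=` Q].

Section ExtensionGraph.
Variable G : sgraph.

Definition gen_conjugate : pred (raag G) :=
  fun x => `[< exists (g : raag G) (v : G), x = g * std_gen v * g^-1 >].

Definition ext_vertex : choiceType := {x : raag G | gen_conjugate x}.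

Definition ext_adj : rel ext_vertex := fun x y =>
  (x != y) && (val x * val y == val y * val x).

Fact ext_adj_sym : symmetric ext_adj.
Proof. by move=> x y; rewrite /ext_adj eq_sym; congr (_ && _); rewrite eq_sym. Qed.

Fact ext_adj_irrefl : irreflexive ext_adj.
Proof. by move=> x; rewrite /ext_adj eqxx. Qed.

Definition ext_graph : sgraph :=
  @SGraph ext_vertex ext_adj ext_adj_sym ext_adj_irrefl.

Definition clique_subgroup (K : clique_graph ext_graph) : set (raag G) :=
  generated [set val x | x in [set` (val K : {fset ext_graph})]].

End ExtensionGraph.

(* Main.v *)
Require Import Defs.
From HB Require Import structures.
From mathcomp Require Import all_boot all_order all_algebra finmap generic_quotient.
From mathcomp Require Import boolp classical_sets.
From mathcomp Require Import zify.

(** Why the theorem holds.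

    A vertex s of the extension graph is a conjugate g v g^-1.  Its axis gives
    every element x of A(G) an integer position, depth v (g^-1 x), where
    depth v y is the exponent of the v-syllable that can be shuffled to the
    front of y.  Multiplication by s shifts the position along s by 1, and
    multiplication by a vertex adjacent to s does not change it.  For two
    distinct nonadjacent vertices there is a Behrstock inequality: every x has
    a small position along one of the two axes ([axes_dichotomy]).  The bound
    depends only on the pair, so finitely many vertices have a common bound N,
    and with M = 2 N + 1 a ping-pong argument shows that s |-> s^(M n_s) is
    injective on the right-angled Artin group of the graph L that these
    vertices span, for all nonzero exponents n_s simultaneously
    ([powers_injective]).  This is the uniformity that is needed, because
    supp(g_K) = P_K forces g_K to be a product of powers s^(n_s), s in K, with
    every n_s nonzero ([supp_clique_powers]).

    It remains to see that K |-> product of the vertices of K is injective from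
    A(Delta) to A(L).  This is where squares matter: in a 4-cycle a, b, c, d,
    replacing a and b by x = ab sends the nontrivial element [[x, c], d] to
    [[a, c], d] = 1.  If G has no induced square then neither has its extension
    graph ([ext_square_free]), hence neither has L.  The cliques are then split
    one vertex at a time.  A single step merges two adjacent vertices u, v of a
    square-free graph into one vertex x, with link lk(u) meet lk(v), and sends x
    to v u; another ping-pong argument shows that this is injective
    ([merge_injective]).  Square-freeness survives each step
    ([family_square_free]).

    Everything about A(G) itself is deduced from the three properties
    [depth_same], [depth_adj], [depth_nadj] of depth.  The function comes from
    an action of A(G) on pilings, and the general ping-pong lemma [pingpong]
    turns it into a description of leading letters ([lead_aligned]), of lengths
    of products ([len_product]) and of double cosets of star subgroups
    ([double_coset_dichotomy]). *)

Set Implicit Arguments.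
Unset Strict Implicit.
Unset Printing Implicit Defensive.

Import Order.TTheory GRing.Theory Num.Theory.
Local Open Scope quotient_scope.
Local Open Scope group_scope.

(** * Homomorphisms out of a right-angled Artin group *)
Section GroupMorphism.
Variables (A B : groupType) (f : {multiplicative A -> B}).

Fact hom_1 : f 1 = 1.
Proof. by apply: (mulgI (f 1)); rewrite -gmulfM !mulg1. Qed.

Fact hom_V x : f x^-1 = (f x)^-1.
Proof. by apply/divg1_eq; rewrite invgK -gmulfM mulVg hom_1. Qed.

Fact hom_inj : (forall x, f x = 1 -> x = 1) -> injective f.
Proof. by move=> fI x y xy; apply/divg1_eq/fI; rewrite gmulfM hom_V xy divgg. Qed.

End GroupMorphism.

Section Words.
Variable G : sgraph.
Implicit Types (l m : G * bool) (w : word G) (g h : raag G).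

Definition wordg w : raag G := \pi_(raag G) w.

Definition letter l : raag G := wordg [:: l].

Definition flip l : G * bool := (l.1, ~~ l.2).

Lemma flipK : involutive flip.
Proof. by case=> v b; rewrite /flip negbK. Qed.

Lemma wordg_nil : wordg [::] = 1.
Proof. by []. Qed.

Lemma wordg_cat w1 w2 : wordg (w1 ++ w2) = wordg w1 * wordg w2.
Proof. by rewrite /wordg -raag_mulE. Qed.

Lemma wordg_cons l w : wordg (l :: w) = letter l * wordg w.
Proof. by rewrite -cat1s wordg_cat. Qed.

Lemma wordg_repr g : wordg (repr g) = g.
Proof. exact: reprK. Qed.

Lemma wordg_inv w : wordg (word_inv w) = (wordg w)^-1.
Proof. by rewrite /wordg -raag_invE. Qed.

Lemma letter_flip l : letter (flip l) = (letter l)^-1.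
Proof. by rewrite /letter -wordg_inv. Qed.

Lemma letter_true (v : G) : letter (v, true) = std_gen v.
Proof. by []. Qed.

Lemma letter_false (v : G) : letter (v, false) = (std_gen v)^-1.
Proof. exact: (letter_flip (v, true)). Qed.

Lemma raag_letter_ind (P : raag G -> Prop) :
  P 1 -> (forall l g, P g -> P (letter l * g)) -> forall g, P g.
Proof.
move=> P1 PM g; rewrite -(wordg_repr g); elim: (repr g) => [|l w IHw] //.
by rewrite wordg_cons; apply: PM.
Qed.

Lemma std_gen_comm (u v : G) : adj u v -> commute (std_gen u) (std_gen v).
Proof.
move=> uv; rewrite /commute -!letter_true -!wordg_cat.
by apply/raag_eqP; apply: word_eq_comm.
Qed.

Lemma letter_comm l m : adj l.1 m.1 -> commute (letter l) (letter m).
Proof.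
case: l m => [u a] [v b] /= /std_gen_comm uv.
have lV: commute (letter (u, a)) (std_gen v).
  case: a; rewrite ?letter_false //.
  by apply: commute_sym; apply: commuteV; apply: commute_sym.
by case: b; rewrite ?letter_false //; apply: commuteV.
Qed.

End Words.

Section Lift.
Variables (G : sgraph) (A : groupType) (f : G -> A).

Definition eval_letter (l : G * bool) : A := if l.2 then f l.1 else (f l.1)^-1.

Definition eval_word (w : word G) : A := \prod_(l <- w) eval_letter l.

Hypothesis f_comm : forall u v, adj u v -> commute (f u) (f v).

Lemma eval_word_eq w1 w2 : word_eq w1 w2 -> eval_word w1 = eval_word w2.
Proof.
rewrite /eval_word; elim=> //.
- by move=> w w2' w3 _ -> _ ->.
- by move=> w w' w2' w2'' _ e1 _ e2; rewrite !big_cat /= e1 e2.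
- move=> v b; rewrite big_cons big_seq1 big_nil /eval_letter.
  by case: b; rewrite /= ?mulgV ?mulVg.
- by move=> u v uv; rewrite !big_cons !big_nil !mulg1; apply: f_comm.
Qed.

(** The commutation proof is an argument so that the multiplicative structure
    can be attached to the lift; the section hypothesis alone would not occur
    in its body. *)
Definition raag_lift of (forall u v, adj u v -> commute (f u) (f v)) :=
  fun g : raag G => eval_word (repr g).

Fact raag_lift_is_multiplicative : {morph raag_lift f_comm : x y / x * y}.
Proof.
move=> g h; rewrite /raag_lift /eval_word -big_cat /=.
by apply: eval_word_eq; apply: raag_reprP.
Qed.

HB.instance Definition _ := isMultiplicative.Build (raag G) A
  (raag_lift f_comm) raag_lift_is_multiplicative.

Lemma raag_lift_gen v : raag_lift f_comm (std_gen v) = f v.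
Proof.
rewrite /raag_lift (eval_word_eq (raag_reprP _)).
by rewrite /eval_word big_seq1.
Qed.

End Lift.

Lemma raag_hom_exists (G : sgraph) (A : groupType) (f : G -> A) :
  (forall u v, adj u v -> commute (f u) (f v)) ->
  exists phi : {multiplicative raag G -> A}, forall v, phi (std_gen v) = f v.
Proof. by move=> fC; exists (raag_lift fC) => v; apply: raag_lift_gen. Qed.

Lemma raag_hom_ext (G : sgraph) (A : groupType)
    (phi psi : {multiplicative raag G -> A}) :
  (forall v, phi (std_gen v) = psi (std_gen v)) -> phi =1 psi.
Proof.
move=> e; elim/raag_letter_ind => [|[v b] g IHg]; first by rewrite !hom_1.
by rewrite !gmulfM IHg; case: b; rewrite ?letter_false ?hom_V e.
Qed.

(** * Pilings and initial syllables *)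
Section Pilings.
Variable G : sgraph.
Implicit Types (l m : G * bool) (p q : G -> seq (option bool)).

(** A piling has one stack per vertex.  Placing the letter (v, b) puts its sign
    on the stack of v and a blank on the stacks of all vertices that do not
    commute with v.  So a letter is visible on top of its stack exactly when it
    can be shuffled to the front of the word. *)
Definition push l p : G -> seq (option bool) := fun y =>
  if y == l.1 then Some l.2 :: p y else if adj l.1 y then p y else None :: p y.

Definition pop (v : G) p : G -> seq (option bool) := fun y =>
  if adj v y then p y else behead (p y).

Definition top p v : option bool := head None (p v).

Definition pact l p := if top p l.1 == Some (~~ l.2) then pop l.1 p else push l p.

(** The pilings of reduced words. *)
Inductive piling : (G -> seq (option bool)) -> Prop :=
| piling0 : piling (fun=> [::])
| pilingS l p : piling p -> top p l.1 != Some (~~ l.2) -> piling (push l p).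

Lemma popK l p : pop l.1 (push l p) = p.
Proof.
apply: funext => y; rewrite /pop /push; case: eqP => [->|_]; first by rewrite adj_irrefl.
by case: ifP => // ->.
Qed.

Lemma top_push_adj l p y : adj l.1 y -> top (push l p) y = top p y.
Proof.
rewrite /top /push => ly; case: eqP => [e|_]; last by rewrite ly.
by rewrite e adj_irrefl in ly.
Qed.

Lemma top_pop_adj v p y : adj v y -> top (pop v p) y = top p y.
Proof. by rewrite /top /pop => ->. Qed.

Lemma top_push l p : top (push l p) l.1 = Some l.2.
Proof. by rewrite /top /push eqxx. Qed.

Lemma top_push_nadj l p y : y != l.1 -> ~~ adj l.1 y -> top (push l p) y = None.
Proof. by rewrite /top /push => /negbTE-> /negbTE->. Qed.

Lemma push_comm l m p : adj l.1 m.1 -> push l (push m p) = push m (push l p).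
Proof.
move=> lm; have ml : adj m.1 l.1 by rewrite adj_sym.
have ne : l.1 != m.1 by apply: contraTneq lm => ->; rewrite adj_irrefl.
apply: funext => y; rewrite /push.
have [->|yl] := eqVneq y l.1; first by rewrite (negbTE ne) ml.
have [->|ym] := eqVneq y m.1; first by rewrite lm.
by case: ifP; case: ifP.
Qed.

Lemma pop_comm u v p : pop u (pop v p) = pop v (pop u p).
Proof. by apply: funext => y; rewrite /pop; case: ifP; case: ifP. Qed.

(** Exchange property: a letter visible on top of a piling may be taken to be
    the last one placed, because everything placed after it commutes with
    it. *)
Lemma piling_top p v b : piling p -> top p v = Some b ->
  exists q, [/\ piling q, top q v != Some (~~ b) & p = push (v, b) q].
Proof.
move=> vp; elim: vp v b => [|[y c] q vq IHq ytop] v b //=.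
have [->|vy] := eqVneq v y.
  by rewrite (top_push (y, c)) => -[<-]; exists q.
have [yv|yv] := boolP (adj y v); last by rewrite top_push_nadj.
rewrite top_push_adj // => /IHq[r [vr rtop def_q]].
exists (push (y, c) r); split; last 2 first.
- by rewrite top_push_adj.
- by rewrite def_q push_comm.
apply: pilingS => //; apply: contraNN ytop => /eqP rv; apply/eqP.
by rewrite -rv def_q top_push_adj //= adj_sym.
Qed.

Lemma piling_pop p v b : piling p -> top p v = Some b -> piling (pop v p).
Proof. by move=> vp /(piling_top vp)[q [? _ ->]]; rewrite (popK (v, b)). Qed.

Lemma piling_pact l p : piling p -> piling (pact l p).
Proof.
move=> vp; rewrite /pact; case: eqP => [/piling_pop|/eqP]; first exact.
exact: pilingS.
Qed.

Lemma pactK l p : piling p -> pact (flip l) (pact l p) = p.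
Proof.
case: l => v b vp; rewrite {2}/pact /=; case: eqP => [|ntop].
  case/(piling_top vp) => q [vq qtop ->]; rewrite (popK (v, ~~ b)) /pact /=.
  by rewrite (negbTE qtop).
by rewrite /pact (top_push (v, b)) /= negbK eqxx (popK (v, b)).
Qed.

Lemma top_pact_adj l p v : adj l.1 v -> top (pact l p) v = top p v.
Proof.
by move=> lv; rewrite /pact; case: ifP; rewrite ?top_pop_adj ?top_push_adj.
Qed.

Lemma pact_comm l m p : piling p -> adj l.1 m.1 ->
  pact l (pact m p) = pact m (pact l p).
Proof.
move=> vp lm; have ml : adj m.1 l.1 by rewrite adj_sym.
rewrite {1}/pact top_pact_adj // [in RHS]/pact top_pact_adj // /pact.
have swap a b : adj a.1 b.1 -> top p b.1 = Some (~~ b.2) ->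
    push a (pop b.1 p) = pop b.1 (push a p).
  move=> ab /(piling_top vp)[q [_ _ ->]].
  by rewrite push_comm //= (popK (b.1, ~~ b.2) q) (popK (b.1, ~~ b.2)).
case: eqP => mtop; case: eqP => ltop.
- by rewrite pop_comm.
- by rewrite swap.
- by rewrite swap.
- exact: push_comm.
Qed.

Definition pacts (w : word G) p := foldr pact p w.

Lemma piling_pacts w p : piling p -> piling (pacts w p).
Proof. by move=> vp; elim: w => //= l w; apply: piling_pact. Qed.

Lemma pacts_eq w1 w2 : word_eq w1 w2 -> forall p, piling p -> pacts w1 p = pacts w2 p.
Proof.
rewrite /pacts; elim=> //.
- by move=> w w' _ IH p vp; rewrite IH.
- by move=> w w' w'' _ IH1 _ IH2 p vp; rewrite IH1 ?IH2.
- move=> w w' w2' w2'' _ IH1 _ IH2 p vp.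
  by rewrite !foldr_cat IH2 // IH1 //; apply: piling_pacts.
- by move=> v b p vp; rewrite /= -{2}(pactK (v, ~~ b) vp) /flip /= negbK.
- by move=> u v uv p vp /=; apply: pact_comm.
Qed.

Definition pile_of (g : raag G) := pacts (repr g) (fun=> [::]).

Lemma pile_ofP g : piling (pile_of g).
Proof. by apply: piling_pacts; apply: piling0. Qed.

Lemma pile_of1 : pile_of 1 = fun=> [::].
Proof. by rewrite /pile_of (pacts_eq (raag_reprP _)) //; apply: piling0. Qed.

Lemma pile_ofM l g : pile_of (letter l * g) = pact l (pile_of g).
Proof.
rewrite -{1}(wordg_repr g) -wordg_cons.
by rewrite /pile_of (pacts_eq (raag_reprP _)) //; apply: piling0.
Qed.

(** Signs on a stack between two blanks belong to one syllable; their sum is its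
    exponent. *)
Fixpoint run (s : seq (option bool)) : int := match s with
  | Some b :: s' => ((if b then 1 else - 1) + run s')%R
  | _ => 0%R
  end.

Definition sgn (b : bool) : int := (if b then 1 else - 1)%R.

(** The exponent of the v-syllable that can be shuffled to the front of g. *)
Definition depth (v : G) (g : raag G) : int := run (pile_of g v).

Lemma depth1 v : depth v 1 = 0%R.
Proof. by rewrite /depth pile_of1. Qed.

Lemma depth_same v b g : depth v (letter (v, b) * g) = (sgn b + depth v g)%R.
Proof.
rewrite /depth pile_ofM /pact; case: eqP => [|_] /=; last by rewrite /push eqxx.
rewrite /pop /top adj_irrefl; case: (pile_of g v) => //= _ s -> /=.
by case: b => /=; lia.
Qed.

Lemma depth_adj l v g : adj l.1 v -> depth v (letter l * g) = depth v g.
Proof.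
move=> lv; rewrite /depth pile_ofM /pact; case: ifP => _; rewrite /pop /push lv //.
by case: eqP lv => // ->; rewrite adj_irrefl.
Qed.

Lemma depth_nadj v w g : v != w -> ~~ adj v w -> depth v g = 0%R \/ depth w g = 0%R.
Proof.
move=> vw nvw; rewrite /depth.
case def_s: (pile_of g v) => [|[b|] s]; [by left| |by left].
have: top (pile_of g) v = Some b by rewrite /top def_s.
case/(piling_top (pile_ofP g)) => q [_ _ ->]; right.
by rewrite /push eq_sym (negbTE vw) (negbTE nvw).
Qed.

End Pilings.

(** * Word length and ping-pong *)
Section Length.
Variable G : sgraph.
Implicit Types (l m : G * bool) (w : word G) (g h : raag G).

Fact len_subproof g : exists n, `[< exists2 w, wordg w = g & size w = n >].
Proof. by exists (size (repr g)); apply/asboolP; exists (repr g); rewrite ?wordg_repr. Qed.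

Definition len g : nat := ex_minn (len_subproof g).

Lemma len_word g : exists2 w, wordg w = g & size w = len g.
Proof. by rewrite /len; case: ex_minnP => n /asboolP. Qed.

Lemma len_wordg w : len (wordg w) <= size w.
Proof. by rewrite /len; case: ex_minnP => n _; apply; apply/asboolP; exists w. Qed.

Lemma len1 : len 1 = 0.
Proof. by apply/eqP; rewrite -leqn0 -(wordg_nil G) len_wordg. Qed.

Lemma len_eq0 g : (len g == 0) = (g == 1).
Proof.
apply/eqP/eqP => [|->]; last exact: len1.
by have [w <- <-] := len_word g => /size0nil->.
Qed.

Lemma len_letter l : len (letter l) <= 1.
Proof. exact: (len_wordg [:: l]). Qed.

Lemma lenM g h : len (g * h) <= len g + len h.
Proof.
have [[w <- <-] [w' <- <-]] := (len_word g, len_word h).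
by rewrite -wordg_cat -size_cat len_wordg.
Qed.

Lemma lenV g : len g^-1 = len g.
Proof.
have le h : len h^-1 <= len h.
  have [w <- <-] := len_word h; rewrite -wordg_inv.
  by apply: leq_trans (len_wordg _) _; rewrite size_map size_rev.
by apply/eqP; rewrite eqn_leq le -{1}(invgK g) le.
Qed.

Lemma len_letterM l g : len (letter l * g) <= (len g).+1.
Proof. by apply: leq_trans (lenM _ _) _; rewrite -add1n leq_add2r len_letter. Qed.

Lemma lenM_letter g l : len (g * letter l) <= (len g).+1.
Proof. by rewrite -lenV invgM -letter_flip -(lenV g) len_letterM. Qed.

Definition lead l g := len g == (len ((letter l)^-1 * g)).+1.
Definition trail l g := len g == (len (g * (letter l)^-1)).+1.

Lemma trailV l g : trail l g = lead (flip l) g^-1.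
Proof. by rewrite /trail /lead letter_flip invgK lenV -(lenV (g * _)) invgM invgK. Qed.

Lemma lead_exists g : g != 1 -> exists l, lead l g.
Proof.
rewrite -len_eq0; have [[|l w] def_g sz_w] := len_word g; first by rewrite -sz_w.
move=> _; exists l; rewrite /lead.
have def_h : (letter l)^-1 * g = wordg w by rewrite -def_g wordg_cons mulKg.
rewrite def_h -sz_w eqSS eqn_leq len_wordg andbT.
have := len_letterM l (wordg w); rewrite -wordg_cons def_g -sz_w /=.
by rewrite ltnS.
Qed.

Lemma trail_exists g : g != 1 -> exists l, trail l g.
Proof.
rewrite -invg_eq1 => /lead_exists[l lg]; exists (flip l).
by rewrite trailV flipK.
Qed.

Lemma leadP l g : lead l g -> exists2 h : raag G, g = letter l * h & len g = (len h).+1.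
Proof. by move=> /eqP e; exists ((letter l)^-1 * g); rewrite ?mulVKg. Qed.

Lemma trailP l g : trail l g -> exists2 h : raag G, g = h * letter l & len g = (len h).+1.
Proof. by move=> /eqP e; exists (g * (letter l)^-1); rewrite ?mulgVK. Qed.

Lemma leadE l h : len (letter l * h) = (len h).+1 -> lead l (letter l * h).
Proof. by rewrite /lead mulKg => ->. Qed.

(** A suffix of a reduced expression has no trailing letters of its own. *)
Lemma trail_suffix l m h :
  len (letter l * h) = (len h).+1 -> trail m h -> trail m (letter l * h).
Proof.
rewrite /trail => e1 /eqP e2; rewrite e1 eqSS -mulgA eqn_leq.
have := lenM_letter (letter l * (h * (letter m)^-1)) m.
by rewrite -!mulgA mulVg mulg1 e1 ltnS => ->; rewrite e2 len_letterM.
Qed.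

(** Letterwise form of the ping-pong lemma, by induction along a reduced
    expression l h of g.  If a leading letter m of h fails to commute with l,
    then m is played before l.  If m commutes with l, then m is pulled in front
    and l is played in the shorter element.  The base point is arbitrary: one
    outside all the sets gives injectivity, while a variable one controls
    the cancellation in a product. *)
Lemma pingpong (A : groupType) (phi : {multiplicative raag G -> A})
    (X : G * bool -> A -> Prop) (x : A) :
  (forall l y, X l y -> X l (phi (letter l) * y)) ->
  (forall l m y, l.1 != m.1 -> ~~ adj l.1 m.1 -> X m y ->
     X l (phi (letter l) * y)) ->
  (forall l m y, adj l.1 m.1 -> X m y -> X m (phi (letter l) * y)) ->
  forall g, (forall m, trail m g -> X m (phi (letter m) * x)) ->
  forall l, lead l g -> X l (phi g * x).
Proof.
move=> Xsame Xnadj Xadj g; have [n] := ubnP (len g).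
elim: n g => // n IHn g; rewrite ltnS => le_g trail_g l lead_g.
have [h def_g len_g] := leadP lead_g.
have [h1|nt_h] := eqVneq h 1.
  have gE : g = letter l by rewrite def_g h1 mulg1.
  rewrite gE; apply: trail_g; rewrite /trail gE mulgV len1.
  by rewrite -gE len_g h1 len1.
have trail_h m : trail m h -> trail m g.
  by move=> mh; rewrite def_g; apply: trail_suffix => //; rewrite -def_g.
have [m lead_h] := lead_exists nt_h.
have Xm : X m (phi h * x).
  apply: IHn => // [|k /trail_h/trail_g //].
  by apply: leq_trans le_g; rewrite len_g.
have [h' def_h len_h] := leadP lead_h.
rewrite def_g gmulfM -mulgA.
have [eq_lm|ne_lm] := eqVneq l.1 m.1.
  have [eq2|ne2] := eqVneq l.2 m.2.
    by apply: Xsame; rewrite (surjective_pairing l) eq_lm eq2 -surjective_pairing.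
  have m_flip : m = flip l.
    rewrite (surjective_pairing m) /flip eq_lm; congr (_, _).
    by move: ne2; case: l.2; case: m.2.
  have : g = h' by rewrite def_g def_h m_flip letter_flip mulVKg.
  by move=> gh'; move: len_g; rewrite len_h gh'; lia.
have [adj_lm|nadj_lm] := boolP (adj l.1 m.1); last exact: Xnadj Xm.
pose g' := letter l * h'.
have def_g' : g = letter m * g'.
  by rewrite def_g def_h !mulgA (letter_comm adj_lm).
have len_g' : len g = (len g').+1.
  have := len_letterM m g'; have := len_letterM l h'.
  by rewrite -def_g' -/g'; move: len_g len_h; lia.
have -> : phi (letter l) * (phi h * x) = phi (letter m) * (phi g' * x).
  by rewrite !mulgA -!gmulfM -def_g -def_g'.
apply: Xadj; first by rewrite adj_sym.
apply: IHn => [|k kg'|]; first by apply: leq_trans le_g; rewrite len_g'.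
- by apply: trail_g; rewrite def_g'; apply: trail_suffix => //; rewrite -def_g'.
- by apply: leadE; rewrite -/g'; move: len_g len_h len_g'; lia.
Qed.

Lemma pingpong_injective (A : groupType) (phi : {multiplicative raag G -> A})
    (X : G * bool -> A -> Prop) (x : A) :
  (forall l y, X l y -> X l (phi (letter l) * y)) ->
  (forall l m y, l.1 != m.1 -> ~~ adj l.1 m.1 -> X m y ->
     X l (phi (letter l) * y)) ->
  (forall l m y, adj l.1 m.1 -> X m y -> X m (phi (letter l) * y)) ->
  (forall l, X l (phi (letter l) * x)) -> (forall l, ~ X l x) ->
  injective phi.
Proof.
move=> Xsame Xnadj Xadj Xx nXx; apply: hom_inj => g phig1.
apply: contrapT => /eqP/lead_exists[l lead_g]; apply: (nXx l).
by rewrite -[x]mul1g -phig1; apply: pingpong lead_g.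
Qed.

End Length.

(** * Leading letters, cancellation and reduced products *)
Section Depth.
Variable G : sgraph.
Implicit Types (l m : G * bool) (g h x : raag G) (v w : G).

(** The ping-pong set of a letter for the action of A(G) on itself. *)
Definition aligned l g : bool := (0 < sgn l.2 * depth l.1 g)%R.

Lemma aligned_neq0 l g : aligned l g -> depth l.1 g != 0%R.
Proof. by rewrite /aligned; apply: contraTneq => ->; rewrite mulr0. Qed.

Lemma depth_letter0 l x : depth l.1 x = 0%R -> aligned l (letter l * x).
Proof.
by case: l => v b /= e; rewrite /aligned depth_same /= e; case: b.
Qed.

Lemma aligned_same l x : aligned l x -> aligned l (letter l * x).
Proof.
by case: l => v b /=; rewrite /aligned depth_same /sgn /=; case: b; lia.
Qed.

Lemma aligned_nadj l m x :
  l.1 != m.1 -> ~~ adj l.1 m.1 -> aligned m x -> aligned l (letter l * x).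
Proof.
move=> lm nlm /aligned_neq0 mx; apply: depth_letter0.
by case: (depth_nadj x lm nlm) => // m0; rewrite m0 eqxx in mx.
Qed.

Lemma aligned_adj l m x : adj l.1 m.1 -> aligned m x -> aligned m (letter l * x).
Proof. by rewrite /aligned => lm; rewrite depth_adj. Qed.

(** Ping-pong for A(G) acting on itself: the hypothesis says that no trailing
    letter of g cancels against x, so the front of g survives in g x. *)
Lemma lead_product g x l :
  (forall m, trail m g -> aligned m (letter m * x)) -> lead l g ->
  aligned l (g * x).
Proof.
move=> tr; apply: (@pingpong _ _ idfun (fun l y => aligned l y)) => //=.
- exact: aligned_same.
- exact: aligned_nadj.
- exact: aligned_adj.
Qed.

(** Depth detects leading letters.  Ping-pong gives one direction.  Conversely,
    a letter aligned with g is either the first letter of a reduced expression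
    or commutes with it, by [depth_nadj], and then leads the rest. *)
Lemma lead_aligned l g : lead l g = aligned l g.
Proof.
apply/idP/idP => [lg|].
  rewrite -[g]mulg1; apply: lead_product lg => m _.
  by apply: depth_letter0; rewrite depth1.
have [n] := ubnP (len g); elim: n g l => // n IHn g l; rewrite ltnS => le_g lg.
have nt_g : g != 1.
  by apply: contraTneq lg => ->; rewrite /aligned depth1 mulr0.
have [m mg] := lead_exists nt_g; have [h def_g len_g] := leadP mg.
have am : aligned m g.
  rewrite -[g]mulg1; apply: lead_product mg => k _.
  by apply: depth_letter0; rewrite depth1.
have [eq1|ne1] := eqVneq l.1 m.1.
  suff -> : l = m by [].
  move: lg am; rewrite /aligned (surjective_pairing l) (surjective_pairing m) /= eq1.
  by case: l.2; case: m.2; rewrite /sgn //=; lia.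
have [adj_lm|nadj] := boolP (adj l.1 m.1); last first.
  case: (depth_nadj g ne1 nadj) => e0.
    by move/aligned_neq0: lg; rewrite e0.
  by move/aligned_neq0: am; rewrite e0.
have lh : lead l h.
  apply: IHn; first by apply: leq_trans le_g; rewrite len_g.
  by move: lg; rewrite /aligned def_g depth_adj // adj_sym.
have [h' def_h len_h] := leadP lh.
have def_g2 : g = letter l * (letter m * h').
  by rewrite def_g def_h !mulgA (letter_comm adj_lm).
rewrite def_g2; apply: leadE; rewrite -def_g2.
have := len_letterM l (letter m * h'); have := len_letterM m h'.
by rewrite -def_g2; move: len_g len_h; lia.
Qed.

Lemma len_product g h :
  (forall m, trail m g -> ~~ lead (flip m) h) -> len (g * h) = len g + len h.
Proof.
have [n] := ubnP (len g); elim: n g => // n IHn g; rewrite ltnS => le_g nc.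
have [->|nt_g] := eqVneq g 1; first by rewrite mul1g len1.
have [l lg] := lead_exists nt_g; have [g' def_g len_g] := leadP lg.
have len_g'h : len (g' * h) = len g' + len h.
  apply: IHn => [|m mg']; first by apply: leq_trans le_g; rewrite len_g.
  by apply: nc; rewrite def_g; apply: trail_suffix => //; rewrite -def_g.
have : lead l (g * h).
  rewrite lead_aligned; apply: lead_product lg => m /nc.
  rewrite lead_aligned; case: m => v b; rewrite /aligned depth_same /sgn /=.
  by case: b => /=; lia.
by rewrite /lead {2}def_g -mulgA mulKg len_g'h len_g => /eqP->.
Qed.

Lemma std_gen_neq1 v : std_gen v != 1.
Proof.
apply/eqP => e; have := depth_same v true 1.
by rewrite letter_true e mulg1 depth1.
Qed.

End Depth.

(** * Special subgroups and double cosets of stars *)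
Section Special.
Variable G : sgraph.
Implicit Types (l m : G * bool) (w : word G) (g h x : raag G) (S T : pred G).

Definition special S g : Prop := exists2 w, all (fun l => S l.1) w & wordg w = g.

Lemma special1 S : special S 1.
Proof. by exists [::]. Qed.

Lemma specialM S g h : special S g -> special S h -> special S (g * h).
Proof.
move=> [w Sw <-] [w' Sw' <-]; exists (w ++ w'); last exact: wordg_cat.
by rewrite all_cat Sw.
Qed.

Lemma specialV S g : special S g -> special S g^-1.
Proof.
move=> [w Sw <-]; exists (word_inv w); last exact: wordg_inv.
by rewrite all_map all_rev.
Qed.

Lemma special_letter S l : S l.1 -> special S (letter l).
Proof. by move=> Sl; exists [:: l] => //=; rewrite Sl. Qed.

Lemma special_ind S (P : raag G -> Prop) :
  P 1 -> (forall l g, S l.1 -> P g -> P (letter l * g)) ->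
  forall g, special S g -> P g.
Proof.
move=> P1 PM _ [w Sw <-]; elim: w Sw => //= l w IHw /andP[Sl Sw].
by rewrite wordg_cons; apply: PM => //; apply: IHw.
Qed.

Lemma sub_special S T g : {subset S <= T} -> special S g -> special T g.
Proof. by move=> sST [w Sw <-]; exists w => //; apply: sub_all Sw => l; apply: sST. Qed.

Lemma specialT g : special predT g.
Proof. by exists (repr g); rewrite ?wordg_repr //; apply/allP. Qed.

Fact retr_comm S u v : adj u v ->
  commute (if S u then std_gen u else 1) (if S v then std_gen v else 1).
Proof.
move=> uv; case: (S u); case: (S v); rewrite /commute ?mulg1 ?mul1g //.
exact: std_gen_comm.
Qed.

Definition retr S : {multiplicative raag G -> raag G} := raag_lift (@retr_comm S).

Lemma retr_gen S v : retr S (std_gen v) = if S v then std_gen v else 1.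
Proof. exact: raag_lift_gen. Qed.

Lemma retr_letter S l : retr S (letter l) = if S l.1 then letter l else 1.
Proof.
case: l => v [] /=; first exact: retr_gen.
by rewrite letter_false hom_V retr_gen; case: ifP; rewrite ?invg1.
Qed.

Lemma retr_wordg S w : retr S (wordg w) = wordg (filter (fun l => S l.1) w).
Proof.
elim: w => [|l w IHw]; first exact: hom_1.
by rewrite wordg_cons gmulfM IHw retr_letter /=; case: ifP; rewrite ?wordg_cons ?mul1g.
Qed.

Lemma special_retr S g : special S (retr S g).
Proof.
by rewrite -(wordg_repr g) retr_wordg; eexists; last by []; apply: filter_all.
Qed.

Lemma retr_id S g : special S g -> retr S g = g.
Proof. by case=> w /all_filterP Sw <-; rewrite retr_wordg Sw. Qed.

Lemma len_retr S g : len (retr S g) <= len g.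
Proof.
have [w <- <-] := len_word g; rewrite retr_wordg.
by apply: leq_trans (len_wordg _) _; rewrite size_filter count_size.
Qed.

(** The retraction fixes g, and a leading letter outside S would be killed and
    shorten it. *)
Lemma special_lead S g l : special S g -> lead l g -> S l.1.
Proof.
move=> Sg /leadP[h def_g len_g]; apply: contraT => nSl.
have := len_retr S h; have <- : retr S g = retr S h.
  by rewrite def_g gmulfM retr_letter (negbTE nSl) mul1g.
by rewrite retr_id // len_g ltnn.
Qed.

Lemma special_trail S g l : special S g -> trail l g -> S l.1.
Proof. by move=> /specialV Sg; rewrite trailV; apply: special_lead. Qed.

Definition star (v : G) : pred G := [pred y | (y == v) || adj v y].

Lemma star_commute v a : special (star v) a -> commute a (std_gen v).
Proof.
move: a; apply: special_ind => [|l g]; first by rewrite /commute mulg1 mul1g.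
move=> vl gv; apply/commute_sym/commuteM; last exact/commute_sym.
case/orP: vl => [/eqP <-|vl]; last exact: (letter_comm (l := (v, true))).
case: l => u [] /=; rewrite ?letter_false //; exact: commuteV.
Qed.

Lemma depth_link v S a x : special S a -> {in S, forall y, adj v y} ->
  depth v (a * x) = depth v x.
Proof.
move=> Sa vS; move: a Sa; apply: special_ind => [|l g Sl <-]; first by rewrite mul1g.
by rewrite -mulgA depth_adj // adj_sym vS.
Qed.

Lemma depth_star v a : special (star v) a ->
  exists e : int, forall x, depth v (a * x) = (e + depth v x)%R.
Proof.
move: a; apply: special_ind => [|[u b] g /= ug [e IHg]].
  by exists 0%R => x; rewrite mul1g add0r.
case/orP: ug => [/eqP ->|vu]; last first.
  by exists e => x; rewrite -mulgA depth_adj ?IHg // adj_sym.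
by exists (sgn b + e)%R => x; rewrite -mulgA depth_same IHg addrA.
Qed.

(** A point x with nonzero w-depth starts with w, which blocks the trailing
    letters of h; so h x starts with the letters that start h, and these block
    v. *)
Lemma depth_outside (v w : G) h x :
  h != 1 -> (forall m, lead m h -> ~~ star v m.1) ->
  (forall m, trail m h -> ~~ star w m.1) ->
  depth w x = 0%R \/ depth v (h * x) = 0%R.
Proof.
move=> nt_h Lh Th; have [->|wx] := eqVneq (depth w x) 0%R; [by left|right].
have [l lh] := lead_exists nt_h.
have /aligned_neq0 lhx : aligned l (h * x).
  apply: lead_product lh => m /Th; rewrite negb_or => /andP[mw nmw].
  apply: depth_letter0; case: (depth_nadj x mw); rewrite ?(adj_sym m.1) //.
  by move=> w0; rewrite w0 eqxx in wx.
have := Lh _ lh; rewrite negb_or => /andP[lv nlv].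
case: (depth_nadj (h * x) lv); rewrite ?(adj_sym l.1) //.
by move=> l0; rewrite l0 eqxx in lhx.
Qed.

(** Strip from g the letters of star w on the left and those of star v on the
    right.  What is left is trivial, or satisfies the hypotheses of
    [depth_outside].  The restriction to S serves [special_gate], where the
    factors a and b must not move the depths at all. *)
Lemma double_coset_dichotomy S (v w : G) g : special S g ->
  exists a g0 b : raag G, [/\ g = a * g0 * b,
    special [predI S & star w] a, special [predI S & star v] b &
    g0 = 1 /\ star w v \/
    forall x, depth w x = 0%R \/ depth v (g0^-1 * x) = 0%R].
Proof.
have [n] := ubnP (len g); elim: n g => // n IHn g; rewrite ltnS => le_g Sg.
have [[l lg lw]|noL] := pselect (exists2 l, lead l g & star w l.1).
  have Sl := special_lead Sg lg.
  have [h def_g len_g] := leadP lg.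
  have [||a [g0 [b [def_h Sa Sb D]]]] := IHn h.
  - by apply: leq_trans le_g; rewrite len_g.
  - have -> : h = (letter l)^-1 * g by rewrite def_g mulKg.
    by apply: specialM => //; apply/specialV/special_letter.
  exists (letter l * a), g0, b; split=> //; first by rewrite def_g def_h !mulgA.
  by apply: specialM => //; apply: special_letter; apply/andP; split.
have [[l lg lv]|noT] := pselect (exists2 l, trail l g & star v l.1).
  have Sl := special_trail Sg lg.
  have [h def_g len_g] := trailP lg.
  have [||a [g0 [b [def_h Sa Sb D]]]] := IHn h.
  - by apply: leq_trans le_g; rewrite len_g.
  - have -> : h = g * (letter l)^-1 by rewrite def_g mulgK.
    by apply: specialM => //; apply/specialV/special_letter.
  exists a, g0, (b * letter l); split=> //; first by rewrite def_g def_h !mulgA.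
  by apply: specialM => //; apply: special_letter; apply/andP; split.
exists 1, g, 1; split; rewrite ?mul1g ?mulg1 //; try exact: special1.
(* Nothing can be stripped from g any more. *)
have [->|nt_g] := eqVneq g 1; last first.
  right=> x; apply: depth_outside; rewrite ?invg_eq1 // => m.
    by rewrite -[m]flipK -trailV => mg; apply/negP => mv; apply: noT; exists (flip m).
  by rewrite trailV invgK => mg; apply/negP => mv; apply: noL; exists (flip m).
have [wv|] := boolP (star w v); [by left|rewrite negb_or => /andP[vw nwv]].
by right=> x; rewrite invg1 mul1g; apply: depth_nadj; rewrite // eq_sym.
Qed.

Lemma special_product S T g a b : special S a -> special T b -> g = a * b ->
  exists a' b' : raag G, [/\ special S a', special T b', g = a' * b' &
                    len g = len a' + len b'].
Proof.
have [n] := ubnP (len a + len b); elim: n a b => // n IHn a b.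
rewrite ltnS => le_ab Sa Tb def_g.
have [[m ma mb]|nc] := pselect (exists2 m, trail m a & lead (flip m) b).
  have [[a1 def_a len_a] [b1 def_b len_b]] := (trailP ma, leadP mb).
  apply: (IHn a1 b1).
  - by move: le_ab; rewrite len_a len_b; lia.
  - have -> : a1 = a * (letter m)^-1 by rewrite def_a mulgK.
    by apply: specialM => //; apply/specialV/special_letter; apply: special_trail ma.
  - have -> : b1 = (letter (flip m))^-1 * b by rewrite def_b mulKg.
    apply: specialM => //; apply/specialV/special_letter.
    exact: special_lead mb.
  - by rewrite def_g def_a def_b letter_flip mulgA mulgK.
exists a, b; split=> //; rewrite def_g; apply: len_product => m ma.
by apply/negP => mb; apply: nc; exists m.
Qed.

Lemma lead_productl g h l : len (g * h) = len g + len h -> lead l g -> lead l (g * h).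
Proof.
move=> e /leadP[k def_g len_g]; rewrite def_g -mulgA; apply: leadE.
rewrite mulgA -def_g; have := lenM k h; have := len_letterM l (k * h).
by rewrite mulgA -def_g e len_g; set n := len (k * h); lia.
Qed.

Lemma trail_productr g h l : len (g * h) = len g + len h -> trail l h -> trail l (g * h).
Proof.
move=> e; rewrite !trailV invgM => lh; apply: lead_productl => //.
by rewrite -invgM !lenV e addnC.
Qed.

End Special.

(** * Merging two adjacent vertices of a square-free graph *)
Lemma adj_neq (G : sgraph) (x y : G) : adj x y -> x != y.
Proof. by apply: contraTneq => ->; rewrite adj_irrefl. Qed.

Lemma square_free_chord (G : sgraph) (a b c d : G) : ~ has_induced_square G ->
  adj a b -> adj b c -> adj c d -> adj d a -> a != c -> b != d ->
  ~~ adj a c -> adj b d.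
Proof.
move=> sqf ab bc cd da ac bd nac; apply: contrapT => /negP nbd; apply: sqf.
exists a, b, c, d; split=> //=; rewrite !inE !negb_or ac bd (adj_neq ab).
by rewrite (adj_neq bc) (adj_neq cd) eq_sym (adj_neq da).
Qed.

Section Gate.
Variable G : sgraph.

(** If y and z do not commute, they cannot both lead modulo left multiplication
    by the special subgroup on S.  In [double_coset_dichotomy] for c^-1 the
    outer factors use letters of S in star y and star z, that is in the links of
    y and z, so they leave the two depths unchanged. *)
Lemma special_gate S (y z : G) c r : special S c -> ~~ S y -> ~~ S z ->
  y != z -> ~~ adj y z -> depth y r = 0%R \/ depth z (c * r) = 0%R.
Proof.
move=> Sc Sy Sz yz nyz.
have [a [g0 [b [def_c Sa Sb]]]] := @double_coset_dichotomy _ S z y _ (specialV Sc).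
have linked t d : ~~ S t -> special [predI S & star t] d ->
    forall s, depth t (d^-1 * s) = depth t s.
  move=> St /specialV Sd s; apply: depth_link Sd _ => k /andP[Sk].
  by case/orP=> // /eqP kt; case/negP: St; rewrite -kt.
have def_cr : c * r = b^-1 * (g0^-1 * (a^-1 * r)).
  by rewrite -(invgK c) def_c !invgM !mulgA.
case=> [[_]|/(_ (a^-1 * r))]; first by rewrite /star /= eq_sym (negbTE yz) (negbTE nyz).
by rewrite def_cr (linked y a) // (linked z b).
Qed.

End Gate.

Section Merge.
Variable G : sgraph.
Implicit Types (u v w y z : G) (b : bool) (g c : raag G).

Definition pair_letter u v b : raag G := letter (u, b) * letter (v, b).

(** The letters that may precede a witness y outside star u.  Such a y can lead
    only after all letters u have been removed, so u is allowed among them and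
    the number of its occurrences need not be recorded. *)
Definition side u v : pred G := [pred z | (z == u) || (adj u z && adj v z)].

(** The v-syllable created by the merged generator may cancel while its
    u-syllable survives.  The survivor still blocks everything that does not
    commute with the merged vertex, thanks to a letter y that commutes with v
    but not with u and follows the u-syllable up to common neighbours of u
    and v. *)
Definition half_collapsed u v b g : Prop :=
  aligned (u, b) g /\ exists c y,
    [/\ special (side u v) c, adj v y, ~~ star u y & depth y (c * g) != 0%R].

(** The ping-pong set of the merged vertex. *)
Definition collapsed u v b g : Prop :=
  [\/ aligned (u, b) g /\ aligned (v, b) g, half_collapsed u v b g |
      half_collapsed v u b g].

Lemma pair_letterC u v b : adj u v -> pair_letter u v b = pair_letter v u b.
Proof. by move=> uv; apply: (letter_comm (l := (u, b)) (m := (v, b))). Qed.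

Lemma depth_pair u v b g : adj u v ->
  depth u (pair_letter u v b * g) = (sgn b + depth u g)%R.
Proof. by move=> uv; rewrite -mulgA depth_same depth_adj // adj_sym. Qed.

Lemma aligned_pair u v b g : adj u v ->
  aligned (u, b) g -> aligned (u, b) (pair_letter u v b * g).
Proof. by move=> uv; rewrite /aligned /= depth_pair // /sgn; case: b; lia. Qed.

Lemma aligned_pair0 u v b g : adj u v ->
  depth u g = 0%R -> aligned (u, b) (pair_letter u v b * g).
Proof. by move=> uv e; rewrite /aligned /= depth_pair // e; case: b. Qed.

Lemma half_collapsed_pair u v b g : adj u v ->
  half_collapsed u v b g -> half_collapsed u v b (pair_letter u v b * g).
Proof.
move=> uv [ug [c [y [Sc vy uy cy]]]]; split; first exact: aligned_pair.
exists (c * (letter (u, b))^-1), y; split=> //.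
  by apply: specialM => //; apply/specialV/special_letter; rewrite /side /= eqxx.
have -> : c * (letter (u, b))^-1 * (pair_letter u v b * g) = letter (v, b) * (c * g).
  rewrite -(mulgA _ _ g) !mulgA mulgVK; congr (_ * _).
  have vc : commute c (std_gen v).
    apply: star_commute; apply: sub_special Sc => t.
    rewrite !inE => /orP[/eqP->|/andP[_ ->]]; last by rewrite orbT.
    by rewrite adj_sym uv orbT.
  by case: (b); rewrite ?letter_false //; apply: commuteV.
by rewrite depth_adj.
Qed.

Lemma collapsed_pair u v b g : adj u v ->
  collapsed u v b g -> collapsed u v b (pair_letter u v b * g).
Proof.
move=> uv; have vu : adj v u by rewrite adj_sym.
case=> [[ug vg]|ug|vg].
- apply: Or31; split; first exact: aligned_pair.
  by rewrite pair_letterC //; apply: aligned_pair.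
- by apply: Or32; apply: half_collapsed_pair.
- by apply: Or33; rewrite pair_letterC //; apply: half_collapsed_pair.
Qed.

Lemma half_collapsed_link u v b w e g : adj u w -> adj v w ->
  half_collapsed u v b g -> half_collapsed u v b (letter (w, e) * g).
Proof.
move=> uw vw [ug [c [y [Sc vy uy cy]]]]; split.
  by rewrite /aligned depth_adj // adj_sym.
exists (c * (letter (w, e))^-1), y; split=> //; last by rewrite -mulgA mulKg.
by apply: specialM => //; apply/specialV/special_letter; rewrite /side /= uw vw orbT.
Qed.

Lemma collapsed_link u v b w e g : adj u w -> adj v w ->
  collapsed u v b g -> collapsed u v b (letter (w, e) * g).
Proof.
move=> uw vw; case=> [[ug vg]|ug|vg].
- by apply: Or31; rewrite /aligned !depth_adj // adj_sym.
- by apply: Or32; apply: half_collapsed_link.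
- by apply: Or33; apply: half_collapsed_link.
Qed.

Lemma half_collapsed_start u v b w g : adj u v -> adj v w -> ~~ star u w ->
  depth w g != 0%R -> half_collapsed u v b (pair_letter u v b * g).
Proof.
move=> uv vw uw wg; split.
  apply: aligned_pair0 => //; move: uw; rewrite negb_or => /andP[wu nuw].
  case: (depth_nadj g wu); rewrite ?(adj_sym w) // => w0.
  by rewrite w0 eqxx in wg.
exists (letter (u, b))^-1, w; split=> //.
  by apply/specialV/special_letter; rewrite /side /= eqxx.
by rewrite -(mulgA _ _ g) mulKg depth_adj.
Qed.

Lemma collapsed_start u v b w g : adj u v -> w != u -> w != v ->
  ~~ (adj u w && adj v w) -> depth w g != 0%R ->
  collapsed u v b (pair_letter u v b * g).
Proof.
move=> uv wu wv nw wg; have vu : adj v u by rewrite adj_sym.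
have [uw|nuw] := boolP (adj u w).
  apply: Or33; rewrite pair_letterC //; apply: half_collapsed_start wg => //.
  by move: nw; rewrite uw /= => nvw; rewrite negb_or wv.
have [vw|nvw] := boolP (adj v w).
  by apply: Or32; apply: half_collapsed_start wg => //; rewrite negb_or wu.
have t0 t : w != t -> ~~ adj t w -> depth t g = 0%R.
  rewrite adj_sym => wt ntw; case: (depth_nadj g wt ntw) => // w0.
  by rewrite w0 eqxx in wg.
apply: Or31; split; first by apply: aligned_pair0 => //; apply: t0.
by rewrite pair_letterC //; apply: aligned_pair0 => //; apply: t0.
Qed.

Hypothesis square_free : ~ has_induced_square G.

(** Square-freeness makes the merge work here.  If w commutes with u but not
    with v, then w and the witness y, which commutes with v but not with u,
    cannot commute, as u, v, y, w would be a square.  So w cannot lead where y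
    does. *)
Lemma half_collapsed_depth u v b w g : adj u v -> w != u -> w != v ->
  ~~ (adj u w && adj v w) -> half_collapsed u v b g -> depth w g = 0%R.
Proof.
move=> uv wu wv nw [au [c [y [Sc vy uy cy]]]]; have /= ug := aligned_neq0 au.
have [uw|nuw] := boolP (adj u w); last first.
  case: (depth_nadj g wu); rewrite ?(adj_sym w) // => u0.
  by rewrite u0 eqxx in ug.
rewrite uw /= in nw; move: (uy); rewrite negb_or => /andP[yu nuy].
have wy : w != y by apply: contraNneq nw => ->.
case: (@special_gate _ (side u v) w y c g) => //=.
- by rewrite negb_or wu uw.
- by rewrite negb_or yu (negbTE nuy).
- apply: contraNN nw => wy_adj.
  by apply: (square_free_chord square_free uv vy _ _ _ _ nuy); rewrite 1?eq_sym // adj_sym.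
- by move=> y0; rewrite y0 eqxx in cy.
Qed.

Lemma collapsed_depth u v b w g : adj u v -> w != u -> w != v ->
  ~~ (adj u w && adj v w) -> collapsed u v b g -> depth w g = 0%R.
Proof.
move=> uv wu wv nw; have vu : adj v u by rewrite adj_sym.
case=> [[/aligned_neq0 ug /aligned_neq0 vg]||].
- move: nw; rewrite negb_and => /orP[nuw|nvw].
    case: (depth_nadj g wu); rewrite ?(adj_sym w) // => u0.
    by rewrite u0 eqxx in ug.
  case: (depth_nadj g wv); rewrite ?(adj_sym w) // => v0.
  by rewrite v0 eqxx in vg.
- exact: half_collapsed_depth.
- by apply: half_collapsed_depth; rewrite // andbC.
Qed.

(** Every vertex of H other than x keeps its ping-pong set; x plays with the
    collapsed set of the pair. *)
Lemma merge_injective (H : sgraph) (f : H -> G) (x : H) (v : G)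
    (phi : {multiplicative raag H -> raag G}) :
  injective f -> (forall y : H, f y != v) -> adj (f x) v ->
  (forall y z : H, y != x -> z != x -> adj y z = adj (f y) (f z)) ->
  (forall y : H, y != x -> adj x y = adj (f x) (f y) && adj v (f y)) ->
  (forall y : H, y != x -> phi (std_gen y) = std_gen (f y)) ->
  phi (std_gen x) = std_gen v * std_gen (f x) ->
  injective phi.
Proof.
move=> f_inj fv uv adjE adj_x phiE phi_x; set u := f x in uv adj_x phi_x.
have vu : adj v u by rewrite adj_sym.
have phi_letter (y : H) b : y != x -> phi (letter (y, b)) = letter (f y, b).
  by move=> yx; case: b; rewrite ?letter_false ?hom_V phiE.
have phi_letter_x b : phi (letter (x, b)) = pair_letter u v b.
  rewrite pair_letterC // /pair_letter; case: b => //.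
  rewrite !letter_false hom_V phi_x invgM; apply/commuteV/commute_sym/commuteV.
  exact: std_gen_comm.
have fx (y : H) : y != x -> f y != u by rewrite (inj_eq f_inj).
pose X (l : H * bool) g := if l.1 == x then collapsed u v l.2 g else aligned (f l.1, l.2) g.
apply: (@pingpong_injective _ _ phi X 1).
- move=> [y b] g; rewrite /X /=; have [->|yx] := eqVneq y x.
    by rewrite phi_letter_x; apply: collapsed_pair.
  by rewrite phi_letter //; apply: aligned_same.
- move=> [y b] [z e] g; rewrite /X /=.
  have [->|yx] := eqVneq y x; have [->|zx] := eqVneq z x => //.
  + rewrite adj_x // => _ nxz /aligned_neq0 /= zg; rewrite phi_letter_x.
    by apply: collapsed_start zg; rewrite ?fx.
  + rewrite (adj_sym y) adj_x // => _ nxy xg; rewrite phi_letter //.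
    by apply: (@depth_letter0 _ (f y, b)); apply: collapsed_depth xg; rewrite /= ?fx ?fv.
  + move=> yz; rewrite adjE // phi_letter // => nyz.
    by apply: aligned_nadj => //; rewrite (inj_eq f_inj).
- move=> [y b] [z e] g; rewrite /X /=.
  have [->|yx] := eqVneq y x; have [->|zx] := eqVneq z x => //.
  + by rewrite adj_irrefl.
  + rewrite adj_x // phi_letter_x => /andP[uz vz].
    by rewrite /aligned -mulgA !depth_adj.
  + rewrite (adj_sym y) adj_x // phi_letter // => /andP[uy vy].
    exact: collapsed_link.
  + by rewrite adjE // phi_letter // => yz; apply: aligned_adj.
- move=> [y b]; rewrite /X /=; have [->|yx] := eqVneq y x.
    rewrite phi_letter_x; apply: Or31; split.
      by apply: aligned_pair0; rewrite ?depth1.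
    by rewrite pair_letterC //; apply: aligned_pair0; rewrite ?depth1.
  by rewrite phi_letter //; apply: (@depth_letter0 _ (f y, b)); rewrite depth1.
- have nal l : ~ aligned l (1 : raag G).
    by move/aligned_neq0; rewrite depth1 eqxx.
  move=> [y b]; rewrite /X /=; case: ifP => _; last exact: nal.
  by case=> [[/nal]|[/nal]|[/nal]].
Qed.

End Merge.

(** * Products over disjoint cliques *)
Section CliqueFamily.
Variable G : sgraph.
Hypothesis square_free : ~ has_induced_square G.

Record clique_family (I : eqType) (K : I -> seq G) : Prop := CliqueFamily {
  family_nonempty : forall i, K i != [::];
  family_uniq : forall i, uniq (K i);
  family_clique : forall i x y, x \in K i -> y \in K i -> x != y -> adj x y;
  family_disjoint : forall i j x, x \in K i -> x \in K j -> i = j }.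

Section FamilyGraph.
Variables (I : choiceType) (K : I -> seq G).

Definition family_adj : rel I := fun i j => (i != j) && allrel (@adj G) (K i) (K j).

Fact family_adj_sym : symmetric family_adj.
Proof.
move=> i j; rewrite /family_adj eq_sym; congr (_ && _).
by apply/allrelP/allrelP => h x y Kx Ky; rewrite adj_sym; apply: h.
Qed.

Fact family_adj_irrefl : irreflexive family_adj.
Proof. by move=> i; rewrite /family_adj eqxx. Qed.

Definition family_graph : sgraph := SGraph family_adj_sym family_adj_irrefl.

Hypothesis famK : clique_family K.

(** A square of cliques contains a square of vertices: choose a nonadjacent pair
    in each of the two opposite pairs of cliques. *)
Lemma family_square_free : ~ has_induced_square family_graph.
Proof.
case=> a [b [c [d [abcd [ab bc cd da] nac nbd]]]].
have [x [y [Kx Ky xy nxy]]] : exists x y, [/\ x \in K a, y \in K c, x != y & ~~ adj x y].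
  have ac : a != c by move: abcd; rewrite /= !inE !negb_or; case: (a != c); rewrite ?andbF.
  move: nac; rewrite /adj /= /family_adj ac /= => /allPn[x Kx /allPn[y Ky nxy]].
  exists x, y; split=> //; apply: contraNneq ac => exy.
  by apply/eqP; apply: (family_disjoint famK Kx); rewrite exy.
have [z [t [Kz Kt zt nzt]]] : exists x y, [/\ x \in K b, y \in K d, x != y & ~~ adj x y].
  have bd : b != d by move: abcd; rewrite /= !inE !negb_or; case: (b != d); rewrite ?andbF.
  move: nbd; rewrite /adj /= /family_adj bd /= => /allPn[z Kz /allPn[t Kt nzt]].
  exists z, t; split=> //; apply: contraNneq bd => ezt.
  by apply/eqP; apply: (family_disjoint famK Kz); rewrite ezt.
have adjK i j u v : family_adj i j -> u \in K i -> v \in K j -> adj u v.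
  by case/andP=> _ /allrelP; apply.
case/negP: nzt; apply: (square_free_chord square_free (a := x) (c := y)) => //.
- exact: adjK ab Kx Kz.
- exact: adjK bc Kz Ky.
- exact: adjK cd Ky Kt.
- exact: adjK da Kt Kx.
Qed.

End FamilyGraph.

Lemma full_embedding_injective (H : sgraph) (f : H -> G)
    (phi : {multiplicative raag H -> raag G}) :
  injective f -> (forall x y : H, adj x y = adj (f x) (f y)) ->
  (forall x, phi (std_gen x) = std_gen (f x)) -> injective phi.
Proof.
move=> f_inj fE phiE.
have phi_letter (y : H) b : phi (letter (y, b)) = letter (f y, b).
  by case: b; rewrite ?letter_false ?hom_V phiE.
apply: (@pingpong_injective _ _ phi (fun l g => aligned (f l.1, l.2) g) 1).
- by move=> [y b] g; rewrite phi_letter; apply: aligned_same.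
- move=> [y b] [z e] g /= yz; rewrite fE phi_letter => nyz.
  by apply: aligned_nadj => //; rewrite (inj_eq f_inj).
- by move=> [y b] [z e] g /=; rewrite fE phi_letter => yz; apply: aligned_adj.
- by move=> [y b]; rewrite phi_letter; apply: (@depth_letter0 _ (f y, b)); rewrite depth1.
- by move=> l /aligned_neq0; rewrite depth1 eqxx.
Qed.

Definition clique_prod (s : seq G) : raag G := \prod_(x <- s) std_gen x.

Lemma clique_prod_commute r s : allrel (@adj G) r s ->
  commute (clique_prod r) (clique_prod s).
Proof.
move/allrelP=> rs; rewrite /clique_prod.
rewrite [X in commute X _]big_seq [X in commute _ X]big_seq.
apply: commute_prod => y sy; apply/commute_sym.
apply: commute_prod => x rx; apply/commute_sym.
exact/std_gen_comm/rs.
Qed.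

Lemma sum_ltn (I : eqType) (r : seq I) (E F : I -> nat) i :
  i \in r -> (forall j, E j <= F j) -> E i < F i ->
  \sum_(j <- r) E j < \sum_(j <- r) F j.
Proof.
move=> ri le_EF lt_EF; rewrite !(big_rem i ri) /= -addSn leq_add //.
exact: leq_sum.
Qed.

(** The clique of i loses its vertex v, which becomes the clique of None. *)
Definition split_family (I : eqType) (K : I -> seq G) (i : I) (v : G) (s : seq G) :
    option I -> seq G :=
  fun o => if o is Some j then (if j == i then s else K j) else [:: v].

Section Split.
Variables (I : choiceType) (K : I -> seq G) (i : I) (v : G) (s : seq G).
Hypotheses (famK : clique_family K) (def_Ki : K i = v :: s) (s_neq0 : s != [::]).

Let K1 := split_family K i v s.

Lemma split_family_sub j : {subset K1 (Some j) <= K j}.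
Proof. by move=> x /=; case: eqP => // ->; rewrite def_Ki inE orbC => ->. Qed.

Lemma split_family_clique : clique_family K1.
Proof.
have uKi : uniq (v :: s) by rewrite -def_Ki (family_uniq famK).
have nv j : v \in K1 (Some j) -> False.
  move=> /= v_in; have ij : j = i.
    apply: (family_disjoint famK (split_family_sub v_in)).
    by rewrite def_Ki inE eqxx.
  by move: v_in uKi; rewrite ij eqxx /= => ->.
split.
- by move=> [j|] //=; case: (j =P i) => // _; apply: (family_nonempty famK).
- move=> [j|] //=; case: (j =P i) => // _; last exact: (family_uniq famK).
  by case/andP: uKi.
- move=> [j|] x y; last by rewrite !inE => /eqP-> /eqP->; rewrite eqxx.
  by move=> /split_family_sub Kx /split_family_sub; apply: (family_clique famK) Kx.
- move=> [j|] [k|] x //; rewrite ?(inE, mem_seq1).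
  + by move=> /split_family_sub Kx /split_family_sub /(family_disjoint famK Kx)->.
  + by move=> + /eqP xv; rewrite xv => /nv.
  + by move=> /eqP->  /nv.
Qed.

Lemma split_family_adj_pair : family_adj K1 (Some i) None.
Proof.
rewrite /family_adj /= eqxx; apply/allrelP => x y sx /[!inE]/eqP->.
apply: (family_clique famK (i := i)); rewrite ?def_Ki ?inE ?eqxx ?sx ?orbT //.
apply: contraTneq sx => ->.
by have := family_uniq famK i; rewrite def_Ki => /andP[].
Qed.

Lemma split_family_adj j k : j != i -> k != i ->
  family_adj K j k = family_adj K1 (Some j) (Some k).
Proof. by rewrite /family_adj /= => /negbTE-> /negbTE->. Qed.

Lemma split_family_adj_i k : k != i ->
  family_adj K i k = family_adj K1 (Some i) (Some k) && family_adj K1 None (Some k).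
Proof.
move=> ki; rewrite /family_adj /= eqxx (negbTE ki) def_Ki.
rewrite (inj_eq (@Some_inj _)) allrel_consl allrel1l.
by case: (i != k); rewrite //= andbC.
Qed.

End Split.

Lemma family_hom_exists (I : choiceType) (K : I -> seq G) :
  exists phi : {multiplicative raag (family_graph K) -> raag G},
    forall i : family_graph K, phi (std_gen i) = clique_prod (K i).
Proof. by apply: raag_hom_exists => i j /andP[_]; apply: clique_prod_commute. Qed.

(** Induction on the total number of vertices beyond one per clique.  Splitting
    one vertex off a clique factors the homomorphism through the group of the
    split family, and the first factor is a merge. *)
Lemma clique_family_injective (H : sgraph) (K : H -> seq G) (e : seq H)
    (phi : {multiplicative raag H -> raag G}) :
  clique_family K -> (forall i j : H, adj i j = family_adj K i j) ->
  (forall i, i \in e) -> (forall i, phi (std_gen i) = clique_prod (K i)) ->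
  injective phi.
Proof.
have [n] := ubnP (\sum_(i <- e) (size (K i)).-1).
elim: n H K e phi => // n IHn H K e phi; rewrite ltnS => le_n famK adjE He phiE.
have [[i big_i]|small] := pselect (exists i, 1 < size (K i)); last first.
  have K1 i : exists x, K i == [:: x].
    have := family_nonempty famK i; case def_K: (K i) => [|x [|y s]] // _; first by exists x.
    by case: small; exists i; rewrite def_K.
  pose f i := xchoose (K1 i).
  have Kf i : K i = [:: f i] by apply/eqP; apply: (xchooseP (K1 i)).
  have f_inj : injective f.
    move=> i j fij; apply: (family_disjoint famK (x := f i)).
      by rewrite Kf inE.
    by rewrite Kf fij inE.
  apply: (full_embedding_injective f_inj) => [i j|i].
    rewrite adjE /family_adj !Kf /allrel /= !andbT.
    have [->|//] := eqVneq i j; by rewrite adj_irrefl.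
  by rewrite phiE /clique_prod Kf big_seq1.
case def_Ki: (K i) big_i => [|v s] //=; rewrite ltnS => s_gt0.
have s_neq0 : s != [::] by rewrite -size_eq0 -lt0n.
pose K1 := split_family K i v s.
have famK1 : clique_family K1 by apply: split_family_clique.
have [psi psiE] := family_hom_exists K1.
have psi_inj : injective psi.
  apply: (IHn (family_graph K1) K1 (None :: [seq Some j | j <- e])) => //; last first.
    by move=> [j|]; rewrite inE //=; apply/map_f.
  rewrite big_cons add0n big_map; apply: leq_trans le_n.
  apply: (@sum_ltn _ _ _ _ i) => //= [j|]; last by rewrite eqxx def_Ki /= prednK.
  by case: eqP => // ->; rewrite def_Ki /= leq_pred.
pose t : H -> raag (family_graph K1) := fun j =>
  if j == i then std_gen (None : family_graph K1) * std_gen (Some i : family_graph K1)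
  else std_gen (Some j : family_graph K1).
have [mu muE] : exists mu : {multiplicative raag H -> raag (family_graph K1)},
    forall j, mu (std_gen j) = t j.
  have ti j : j != i -> adj i j -> commute (t i) (t j).
    move=> ji; rewrite adjE (split_family_adj_i def_Ki) // => /andP[ij vj].
    rewrite /t eqxx (negbTE ji); apply: commute_sym; apply: commuteM.
      by apply/commute_sym/std_gen_comm.
    by apply/commute_sym/std_gen_comm.
  apply: raag_hom_exists => j k jk.
  have [ji|ji] := eqVneq j i.
    rewrite ji in jk *; apply: ti => //; rewrite eq_sym; exact: adj_neq jk.
  have [ki|ki] := eqVneq k i.
    by rewrite ki in jk *; apply: commute_sym; apply: ti; rewrite 1?adj_sym.
  rewrite /t (negbTE ji) (negbTE ki); apply: std_gen_comm.
  by move: jk; rewrite adjE (@split_family_adj _ K i v s).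
have mu_inj : injective mu.
  apply: (@merge_injective _ (family_square_free famK1) _ Some i None) => //.
  - exact: Some_inj.
  - exact: split_family_adj_pair.
  - by move=> j k ji ki; rewrite adjE (@split_family_adj _ K i v s).
  - by move=> j ji; rewrite adjE (split_family_adj_i def_Ki).
  - by move=> j ji; rewrite muE /t (negbTE ji).
  - by rewrite muE /t eqxx.
have phi_psi : phi =1 psi \o mu.
  apply: raag_hom_ext => j; rewrite phiE /= muE /t.
  case: eqP => [->|/eqP ji]; last by rewrite psiE /K1 /= (negbTE ji).
  by rewrite gmulfM !psiE /K1 /= eqxx /clique_prod big_seq1 def_Ki big_cons.
by move=> g h; rewrite !phi_psi => /psi_inj/mu_inj.
Qed.

End CliqueFamily.

(** * Integer powers *)
Section IntegerPowers.
Variable A : groupType.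
Implicit Types (x y : A).

Definition zpow x (n : int) : A := match n with
  | Posz k => x ^+ k
  | Negz k => x ^- k.+1
  end.

Lemma zpowN x n : zpow x (- n) = (zpow x n)^-1.
Proof. by case: n => [[|k]|k] //=; rewrite ?invg1 // ?invgK // NegzE opprK. Qed.

Lemma zpowS x n : zpow x (n + 1) = x * zpow x n.
Proof.
case: n => k; first by rewrite -PoszD addn1 /= expgS.
rewrite NegzE; case: k => [|k]; first by rewrite addNr /= mulgV.
rewrite (_ : - k.+2%:Z + 1 = - k.+1%:Z)%R; last by lia.
by rewrite !zpowN /= [in RHS]expgSr invgM mulVKg.
Qed.

Lemma zpow_ind x (P : int -> Prop) :
  P 0%R -> (forall n, P n -> P (n + 1)%R) -> (forall n, P (n + 1)%R -> P n) ->
  forall n, P n.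
Proof.
move=> P0 PS PV [|]; elim=> [|k IHk] //.
- by rewrite -addn1 PoszD; apply: PS.
- by apply: PV; rewrite NegzE addNr.
- by apply: PV; move: IHk; rewrite !NegzE (_ : - k.+2%:Z + 1 = - k.+1%:Z)%R //; lia.
Qed.

Lemma zpowD x m n : zpow x (m + n) = zpow x m * zpow x n.
Proof.
elim/(zpow_ind x): m => [|m IHm|m IHm]; first by rewrite add0r mul1g.
  by rewrite addrAC !zpowS IHm mulgA.
by apply: (mulgI x); rewrite mulgA -!zpowS -IHm addrAC.
Qed.

Lemma commute_zpow x y n : commute x y -> commute x (zpow y n).
Proof.
by move=> xy; case: n => k; [|apply: commuteV]; apply: commuteX.
Qed.

Lemma zpow_shift (c : A -> int) (d : int) x :
  (forall y, c (x * y)%g = d + c y)%R -> forall n y, (c (zpow x n * y)%g = n * d + c y)%R.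
Proof.
move=> cx n; elim/(zpow_ind x): n => [|n IHn|n IHn] y.
- by rewrite mul1g mul0r add0r.
- by rewrite zpowS -mulgA cx IHn mulrDl mul1r; lia.
- by apply: (addrI d); rewrite -cx mulgA -zpowS IHn mulrDl mul1r -addrA addrCA.
Qed.

End IntegerPowers.

(** * Axes of conjugates of standard generators *)
Section Conjugates.
Variable G : sgraph.
Implicit Types (v w : G) (g h a b x s t : raag G).

Definition conj_gen g v : raag G := g * std_gen v * g^-1.

Definition position g v x : int := depth v (g^-1 * x).

Lemma position_self g v x : position g v (conj_gen g v * x) = (1 + position g v x)%R.
Proof. by rewrite /position /conj_gen -!mulgA mulKg -letter_true depth_same. Qed.

Lemma conj_genM g a v : special (star v) a -> conj_gen (g * a) v = conj_gen g v.
Proof.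
move=> /star_commute av; rewrite /conj_gen invgM !mulgA.
by rewrite -(mulgA g) av !mulgA mulgK.
Qed.

Lemma conj_gen_commute g v w : adj v w -> commute (conj_gen g v) (conj_gen g w).
Proof.
move=> /std_gen_comm vw; rewrite /commute /conj_gen !mulgA !mulgVK.
by rewrite -(mulgA g) vw !mulgA.
Qed.

(** The Behrstock inequality for the axes of g v g^-1 and h w h^-1. *)
Definition behrstock (n : nat) g v h w : Prop :=
  forall x, (`|position h w x| <= n%:Z \/ `|position g v x| <= n%:Z)%R.

(** Moving far along both of two commuting axes makes both positions large. *)
Lemma behrstock_not_commute n g v h w :
  behrstock n g v h w -> ~ commute (conj_gen g v) (conj_gen h w).
Proof.
move=> B; set s := conj_gen g v; set t := conj_gen h w => st.
pose N : nat := (n + `|position g v 1%g| + `|position h w 1%g|)%N.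
(* N bounds n and both initial positions, so k steps lead from [-N, N] beyond N. *)
pose k : nat := (2 * N).+1.
have ps (y : raag G) : position g v (zpow s k * y) = (k%:Z + position g v y)%R.
  by rewrite (zpow_shift (@position_self g v)) mulr1.
have pt (y : raag G) : position h w (zpow t k * y) = (k%:Z + position h w y)%R.
  by rewrite (zpow_shift (@position_self h w)) mulr1.
have kst : zpow s k * zpow t k = zpow t k * zpow s k.
  by apply: commute_zpow; apply/commute_sym/commute_zpow/commute_sym.
have := B (zpow s k * zpow t k * 1); rewrite {1}kst -!mulgA pt ps.
have := B (zpow s k * 1); have := B (zpow t k * 1); rewrite pt ps.
set x1 := position g v 1; set x2 := position h w 1.
set x3 := position g v (zpow t k * 1); set x4 := position h w (zpow s k * 1).
by move: x3 x4; rewrite /k /N -/x1 -/x2; lia.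
Qed.

(** Write h^-1 g = a g0 b as in [double_coset_dichotomy].  The factors a and b
    shift the two positions by constants, so the bound for g0 gives the
    Behrstock inequality.  If g0 = 1 and v, w are adjacent, both conjugates
    have the form k v k^-1 and k w k^-1 with k = h a. *)
Lemma axes_dichotomy g v h w : conj_gen g v != conj_gen h w ->
  (exists n, behrstock n g v h w) \/
  [/\ adj v w, commute (conj_gen g v) (conj_gen h w),
      exists a b, [/\ special (star w) a, special (star v) b & h^-1 * g = a * b] &
      forall x, position h w (conj_gen g v * x) = position h w x].
Proof.
move=> st.
have [a [g0 [b [def_hg Sa Sb D]]]] := double_coset_dichotomy v w (specialT (h^-1 * g)).
have {}Sa : special (star w) a by apply: sub_special Sa => k /andP[].
have {}Sb : special (star v) b by apply: sub_special Sb => k /andP[].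
have [ea posa] := depth_star (specialV Sa).
have [eb posb] := depth_star Sb.
have bounded : (forall x, depth w x = 0%R \/ depth v (g0^-1 * x) = 0%R) ->
    exists n, behrstock n g v h w.
  move=> D0; exists (`|ea| + `|eb|)%N => x.
  have posv : position g v x = (- eb + depth v (g0^-1 * (a^-1 * (h^-1 * x)))%g)%R.
    have -> : g0^-1 * (a^-1 * (h^-1 * x)) = b * (g^-1 * x).
      have -> : b * (g^-1 * x) = (g * b^-1)^-1 * x by rewrite invgM invgK mulgA.
      have -> : g * b^-1 = h * a * g0.
        by rewrite -[g](mulVKg h) def_hg !mulgA mulgK.
      by rewrite !invgM !mulgA.
    by rewrite posb; rewrite /position; lia.
  have posw : position h w x = (- ea + depth w (a^-1 * (h^-1 * x))%g)%R.
    by rewrite posa /position; lia.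
  by case: (D0 (a^-1 * (h^-1 * x))) => e; [left; rewrite posw|right; rewrite posv];
    rewrite e; lia.
case: D => [[g01 wv]|D0]; last by left; apply: bounded.
have def_g : g = h * a * b by rewrite -[g](mulVKg h) def_hg g01 mulg1 mulgA.
have def_s : conj_gen g v = conj_gen (h * a) v by rewrite def_g conj_genM.
have def_t : conj_gen h w = conj_gen (h * a) w by rewrite conj_genM.
have wv_adj : adj w v.
  by case/orP: wv => // /eqP vw; move: st; rewrite def_s def_t vw eqxx.
have vw : adj v w by rewrite adj_sym.
right; split=> //.
- by rewrite def_s def_t; apply: conj_gen_commute.
- by exists a, b; split; rewrite // def_hg g01 mulg1.
move=> x; rewrite def_s /position /conj_gen invgM !mulgA mulVg mul1g -!mulgA.
have [ea' posa'] := depth_star Sa.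
by rewrite posa' -letter_true depth_adj // -posa' mulVKg.
Qed.

Lemma commuting_axes g v h w : conj_gen g v != conj_gen h w ->
  commute (conj_gen g v) (conj_gen h w) ->
  [/\ adj v w,
      exists a b, [/\ special (star w) a, special (star v) b & h^-1 * g = a * b] &
      forall x, position h w (conj_gen g v * x) = position h w x].
Proof.
move=> st cst; case: (axes_dichotomy st) => [[n /behrstock_not_commute]|[]] //.
Qed.

Lemma noncommuting_axes g v h w : conj_gen g v != conj_gen h w ->
  ~ commute (conj_gen g v) (conj_gen h w) -> exists n, behrstock n g v h w.
Proof. by move=> st nc; case: (axes_dichotomy st) => [|[]]. Qed.

End Conjugates.

(** * The extension graph of a square-free graph is square-free *)
Section ExtensionSquares.
Variable G : sgraph.
Hypothesis square_free : ~ has_induced_square G.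
Implicit Types (v w p q : G) (g h l : raag G).

Lemma star_neq_adj v p : star v p -> p != v -> adj v p.
Proof. by case/orP=> // /eqP->; rewrite eqxx. Qed.

Lemma lead_lead_adj l m n : lead m l -> lead n l -> m.1 != n.1 -> adj m.1 n.1.
Proof.
rewrite !lead_aligned => /aligned_neq0 ml /aligned_neq0 nl mn.
apply: contraT => /(depth_nadj l mn) [] e; first by rewrite e eqxx in ml.
by rewrite e eqxx in nl.
Qed.

Lemma square_stars_disjoint v w p q : adj v w -> adj p q ->
  star v p -> ~~ star w p -> star w q -> ~~ star v q -> False.
Proof.
move=> vw pq vp nwp wq nvq.
have pv : p != v.
  by apply: contraNneq nwp => ->; rewrite /star /= adj_sym vw orbT.
have qw : q != w by apply: contraNneq nvq => ->; rewrite /star /= vw orbT.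
move: (nvq); rewrite negb_or => /andP[qv nadj_vq].
move: (nwp); rewrite negb_or => /andP[wp /negP[]].
apply: (square_free_chord square_free vw (star_neq_adj wq qw) _ _ _ _ nadj_vq).
- by rewrite adj_sym.
- by rewrite adj_sym star_neq_adj.
- by rewrite eq_sym.
- by rewrite eq_sym.
Qed.

Lemma square_star_adj v w w' p : adj v w -> adj v w' -> w != w' ->
  star w p -> star w' p -> ~~ star v p -> adj w w'.
Proof.
move=> vw vw' ww' wp w'p nvp.
have ne u : adj v u -> p != u.
  by move=> vu; apply: contraNneq nvp => ->; rewrite /star /= vu orbT.
move: (nvp); rewrite negb_or => /andP[pv nadj_vp].
apply: (square_free_chord square_free vw _ _ _ _ ww' nadj_vp).
- by apply: star_neq_adj => //; apply: ne.
- by rewrite adj_sym star_neq_adj // ne.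
- by rewrite adj_sym.
- by rewrite eq_sym.
Qed.

(** Adjacent vertices of the extension graph are simultaneously conjugate to
    standard ones, so a square is given by edges v, w and v', w' and an element
    l = g^-1 h.  Choose l shortest: no leading letter of l lies in both stars of
    v and w, no trailing letter in both stars of v' and w'.  The other two edges
    write l as a reduced product in A(star v) A(star w') and in
    A(star w) A(star v').  Leading letters of the two first factors, or trailing
    letters of the two second factors, or a leading letter of l when l lies in
    one factor of each product, span a forbidden square with v, w, v', w'. *)
Lemma no_conjugate_square g h v w v' w' :
  adj v w -> adj v' w' ->
  commute (conj_gen g w) (conj_gen h v') -> commute (conj_gen h w') (conj_gen g v) ->
  conj_gen g v != conj_gen h v' -> conj_gen g w != conj_gen h w' ->
  conj_gen g w != conj_gen h v' -> conj_gen h w' != conj_gen g v ->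
  ~ commute (conj_gen g v) (conj_gen h v') ->
  ~ commute (conj_gen g w) (conj_gen h w') -> False.
Proof.
move=> vw vw' bc da ac bd bc_neq da_neq nac nbd.
have [n] := ubnP (len (g^-1 * h)); elim: n g h bc da ac bd bc_neq da_neq nac nbd => // n IHn g h.
move=> bc da ac bd bc_neq da_neq nac nbd; rewrite ltnS => le_n.
set l := g^-1 * h in le_n; have def_h : h = g * l by rewrite mulVKg.
have [[m lead_m /andP[vm wm]]|noL] := pselect (exists2 m, lead m l & star v m.1 && star w m.1).
  have [l' def_l len_l] := leadP lead_m.
  have gm u : star u m.1 -> conj_gen g u = conj_gen (g * letter m) u.
    by move=> um; rewrite conj_genM //; apply: special_letter.
  rewrite !(gm v) // !(gm w) // in bc da ac bd bc_neq da_neq nac nbd.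
  apply: (IHn (g * letter m) h) => //.
  by rewrite invgM -mulgA -/l def_l mulKg; apply: leq_trans le_n; rewrite -len_l.
have [[m trail_m /andP[vm wm]]|noT] := pselect (exists2 m, trail m l & star v' m.1 && star w' m.1).
  have [l' def_l len_l] := trailP trail_m.
  have gm u : star u m.1 -> conj_gen h u = conj_gen (h * (letter m)^-1) u.
    by move=> um; rewrite conj_genM //; apply/specialV/special_letter.
  rewrite !(gm v') // !(gm w') // in bc da ac bd bc_neq da_neq nac nbd.
  apply: (IHn g (h * (letter m)^-1)) => //.
  by rewrite mulgA -/l def_l mulgK; apply: leq_trans le_n; rewrite -len_l.
have [adj_w'v [a1' [b1' [Sa1' Sb1' def_l1]]] _] := commuting_axes da_neq da.
have cb_neq : conj_gen h v' != conj_gen g w by rewrite eq_sym.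
have [adj_v'w [a2' [b2' [Sa2' Sb2' def_l2]]] _] := commuting_axes cb_neq (commute_sym bc).
have [a1 [b1 [Sa1 Sb1 def_l1' len1]]] := special_product Sa1' Sb1' def_l1.
have [a2 [b2 [Sa2 Sb2 def_l2' len2]]] := special_product Sa2' Sb2' def_l2.
rewrite -/l in def_l1' def_l2' len1 len2.
have nL m : lead m l -> star v m.1 -> ~~ star w m.1.
  by move=> ml vm; apply/negP => wm; apply: noL; exists m; rewrite ?vm.
have nT m : trail m l -> star v' m.1 -> ~~ star w' m.1.
  by move=> ml vm; apply/negP => wm; apply: noT; exists m; rewrite ?vm.
have nL' m : lead m l -> star w m.1 -> ~~ star v m.1.
  by move=> ml wm; apply/negP => vm; apply: noL; exists m; rewrite ?vm.
have nT' m : trail m l -> star w' m.1 -> ~~ star v' m.1.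
  by move=> ml wm; apply/negP => vm; apply: noT; exists m; rewrite ?vm.
have [nt_a|a_triv] := boolP ((a1 != 1) && (a2 != 1)).
  case/andP: nt_a => /lead_exists[m ma] /lead_exists[k ka].
  have ml : lead m l by rewrite def_l1'; apply: lead_productl => //; rewrite -def_l1'.
  have kl : lead k l by rewrite def_l2'; apply: lead_productl => //; rewrite -def_l2'.
  have vm := special_lead Sa1 ma; have wk := special_lead Sa2 ka.
  apply: (square_stars_disjoint vw _ vm (nL _ ml vm) wk (nL' _ kl wk)).
  apply: (lead_lead_adj ml kl).
  by apply: contraTneq vm => ->; exact: nL' kl wk.
have [nt_b|b_triv] := boolP ((b1 != 1) && (b2 != 1)).
  case/andP: nt_b => /trail_exists[m mb] /trail_exists[k kb].
  have ml : trail m l by rewrite def_l1'; apply: trail_productr => //; rewrite -def_l1'.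
  have kl : trail k l by rewrite def_l2'; apply: trail_productr => //; rewrite -def_l2'.
  have wm := special_trail Sb1 mb; have vk := special_trail Sb2 kb.
  apply: (square_stars_disjoint vw' _ vk (nT _ kl vk) wm (nT' _ ml wm)).
  move: (kl) (ml); rewrite !trailV => kl' ml'; apply: (lead_lead_adj kl' ml').
  by apply: contraTneq vk => /= ->; exact: nT' ml wm.
have [l1|nt_l] := eqVneq l 1.
  have hg : h = g by rewrite def_h l1 mulg1.
  rewrite hg in ac bd nac nbd.
  have vv' : v != v' by apply: contraNneq ac => ->.
  have ww' : w != w' by apply: contraNneq bd => ->.
  have nvv' : ~~ adj v v' by apply/negP => /(conj_gen_commute g).
  apply/nbd/conj_gen_commute/(square_free_chord square_free vw _ vw' adj_w'v vv' ww' nvv').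
  by rewrite adj_sym.
have [a1_1|nt_a1] := eqVneq a1 1; last first.
  (* Here l = a1 = b2, in the stars of v and v'. *)
  have a2_1 : a2 = 1 by apply/eqP; move: a_triv; rewrite nt_a1 /= negbK.
  have lb2 : l = b2 by rewrite def_l2' a2_1 mul1g.
  have nt_b2 : b2 != 1 by rewrite -lb2.
  have b1_1 : b1 = 1 by apply/eqP; move: b_triv; rewrite nt_b2 andbT negbK.
  have la1 : l = a1 by rewrite def_l1' b1_1 mulg1.
  have [m ml] := lead_exists nt_l.
  have vm : star v m.1 by apply: special_lead (ml); rewrite la1.
  have v'm : star v' m.1 by apply: special_lead (ml); rewrite lb2.
  have hv' : conj_gen h v' = conj_gen g v' by rewrite def_h conj_genM // lb2.
  rewrite hv' in ac nac.
  apply/nac/conj_gen_commute/(@square_star_adj w v v' m.1) => //.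
  - by rewrite adj_sym.
  - by rewrite adj_sym.
  - by apply: contraNneq ac => ->.
  - exact: nL.
(* Here l = b1 = a2, in the stars of w and w'. *)
have lb1 : l = b1 by rewrite def_l1' a1_1 mul1g.
have nt_b1 : b1 != 1 by rewrite -lb1.
have b2_1 : b2 = 1 by apply/eqP; move: b_triv; rewrite nt_b1 /= negbK.
have la2 : l = a2 by rewrite def_l2' b2_1 mulg1.
have [m ml] := lead_exists nt_l.
have wm : star w m.1 by apply: special_lead (ml); rewrite la2.
have w'm : star w' m.1 by apply: special_lead (ml); rewrite lb1.
have hw' : conj_gen h w' = conj_gen g w' by rewrite def_h conj_genM // lb1.
rewrite hw' in bd nbd.
apply/nbd/conj_gen_commute/(@square_star_adj v w w' m.1) => //.
- by rewrite adj_sym.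
- by apply: contraNneq bd => ->.
- exact: nL'.
Qed.

Lemma ext_vertexP (s : ext_vertex G) : exists gv : raag G * G, val s = conj_gen gv.1 gv.2.
Proof. by have /asboolP[g [v ->]] := valP s; exists (g, v). Qed.

Definition ext_base (s : ext_vertex G) : raag G := (sval (cid (ext_vertexP s))).1.
Definition ext_label (s : ext_vertex G) : G := (sval (cid (ext_vertexP s))).2.

Lemma ext_valE s : val s = conj_gen (ext_base s) (ext_label s).
Proof. by rewrite /ext_base /ext_label; case: cid. Qed.

Lemma ext_adjP (s t : ext_graph G) : reflect (s != t /\ commute (val s) (val t)) (adj s t).
Proof. by apply: (iffP andP) => -[? /eqP]. Qed.

Lemma ext_edgeP (s t : ext_graph G) : adj s t -> exists g v w,
  [/\ val s = conj_gen g v, val t = conj_gen g w & adj v w].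
Proof.
case/ext_adjP; rewrite -val_eqE /= !ext_valE => st cst.
have [vw [a [b [Sa Sb def_ab]]] _] := commuting_axes st cst.
exists (ext_base t * a), (ext_label s), (ext_label t); split=> //.
  by rewrite -[RHS](conj_genM _ Sb) -mulgA -def_ab mulVKg.
by rewrite conj_genM.
Qed.

Lemma ext_square_free : ~ has_induced_square (ext_graph G).
Proof.
case=> a [b [c [d [abcd [ab bc cd da] nac nbd]]]].
have [g [v [w [def_a def_b vw]]]] := ext_edgeP ab.
have [h [v' [w' [def_c def_d vw']]]] := ext_edgeP cd.
have [bc_neq Cbc] := ext_adjP _ _ bc; have [da_neq Cda] := ext_adjP _ _ da.
have ac : a != c by move: abcd; rewrite /= !inE !negb_or; case: (a != c); rewrite ?andbF.
have bd : b != d by move: abcd; rewrite /= !inE !negb_or; case: (b != d); rewrite ?andbF.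
apply: (@no_conjugate_square g h v w v' w' vw vw').
- by rewrite -def_b -def_c.
- by rewrite -def_a -def_d.
- by rewrite -def_a -def_c.
- by rewrite -def_b -def_d.
- by rewrite -def_b -def_c.
- by rewrite -def_a -def_d.
- by rewrite -def_a -def_c => C; move/negP: nac; apply; apply/ext_adjP.
- by rewrite -def_b -def_d => C; move/negP: nbd; apply; apply/ext_adjP.
Qed.

End ExtensionSquares.

(** * Uniform powers of finitely many vertices of the extension graph *)
Section Powers.
Variable G : sgraph.

Lemma induced_square_free (S : {fset G}) :
  ~ has_induced_square G -> ~ has_induced_square (induced_subgraph S).
Proof.
move=> sqf [a [b [c [d [abcd [ab bc cd da] nac nbd]]]]]; apply: sqf.
by exists (val a), (val b), (val c), (val d).
Qed.

Lemma uniform_bound (T : eqType) (r : seq T) (P : T -> nat -> Prop) :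
  (forall x m n, m <= n -> P x m -> P x n) -> (forall x, exists n, P x n) ->
  exists n, forall x, x \in r -> P x n.
Proof.
move=> Pmono Pex; elim: r => [|x r [n IHr]]; first by exists 0.
have [m Pm] := Pex x; exists (m + n) => y; rewrite inE => /orP[/eqP->|ry].
  exact: Pmono (leq_addr _ _) Pm.
exact: Pmono (leq_addl _ _) (IHr y ry).
Qed.

Definition ext_position (s : ext_graph G) (x : raag G) : int :=
  position (ext_base s) (ext_label s) x.

Lemma ext_position_self s x : ext_position s (val s * x) = (1 + ext_position s x)%R.
Proof. by rewrite /ext_position ext_valE position_self. Qed.

Lemma ext_position_adj (s t : ext_graph G) x : adj s t ->
  ext_position t (val s * x) = ext_position t x.
Proof.
case/ext_adjP; rewrite -val_eqE /= !ext_valE => st cst.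
by rewrite /ext_position; have [_ _ ->] := commuting_axes st cst.
Qed.

Lemma ext_position_nadj (s t : ext_graph G) : s != t -> ~~ adj s t ->
  exists n : nat, forall x,
    (`|ext_position t x| <= n%:Z \/ `|ext_position s x| <= n%:Z)%R.
Proof.
move=> st nst.
apply: (@noncommuting_axes _ (ext_base s) (ext_label s) (ext_base t) (ext_label t));
  rewrite -!ext_valE ?val_eqE //.
by move=> C; move/negP: nst; apply; apply/ext_adjP.
Qed.

Lemma zpow_sgn (x : raag G) (b : bool) n :
  (if b then zpow x n else (zpow x n)^-1) = zpow x (sgn b * n).
Proof. by case: b; rewrite ?mul1r // mulN1r zpowN. Qed.

(** The sign in which the b-signed letter with exponent m moves its own
    position. *)
Definition orient (m : int) (b : bool) : int :=
  (sgn b * (if (0 < m)%R then 1 else -1))%R.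

(** The displacement is d = (2 N + 1) |m|, enough to jump from the interval
    [-N, N] past N. *)
Lemma orient_step (N : nat) (m p : int) b : m != 0%R -> exists d : int,
  [/\ (2 * N%:Z < d)%R, (orient m b * p <= `|p|)%R, (- `|p| <= orient m b * p)%R &
   (orient m b * (sgn b * ((2 * N).+1%:Z * m) + p) = d + orient m b * p)%R].
Proof.
move=> m0; exists ((2 * N).+1%:Z * `|m|)%R.
have : ((2 * N).+1%:Z <= (2 * N).+1%:Z * `|m|)%R by rewrite ler_peMr //; lia.
rewrite /orient /sgn; set q := (_ * `|m|)%R => le_q.
have def_q : q = ((2 * N).+1%:Z * ((if (0 < m)%R then 1 else -1) * m))%R.
  by rewrite /q; congr (_ * _)%R; case: ifP; lia.
split; [lia| | |].
- by case: b; case: ifP; lia.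
- by case: b; case: ifP; lia.
rewrite def_q; case: b; case: ifP; rewrite ?mul1r ?mulN1r ?mulrN ?opprK ?opprD //; lia.
Qed.

(** N bounds the Behrstock constants of all pairs and the positions of the base
    point 1.  The ping-pong set of a signed letter consists of the points whose
    position exceeds N in the direction in which that letter moves. *)
Lemma powers_injective (S : {fset ext_graph G}) : exists2 M : nat, 0 < M &
  forall (n : induced_subgraph S -> int)
         (phi : {multiplicative raag (induced_subgraph S) -> raag G}),
    (forall s, n s != 0%R) ->
    (forall s, phi (std_gen s) = zpow (val (val s)) (M%:Z * n s)%R) ->
    injective phi.
Proof.
pose P (st : S * S) (k : nat) := (`|ext_position (val st.1) 1%g| <= k%:Z)%R /\
  (val st.1 != val st.2 -> ~~ adj (val st.1) (val st.2) -> forall x,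
     (`|ext_position (val st.2) x| <= k%:Z \/ `|ext_position (val st.1) x| <= k%:Z)%R).
have [N boundN] : exists N, forall st, st \in enum {: S * S} -> P st N.
  apply: uniform_bound => [[s t] m k le_mk [Ps Pst]|[s t]].
    have le_mkz : (m%:Z <= k%:Z)%R by [].
    split=> [|st nst x]; first exact: le_trans Ps le_mkz.
    by case: (Pst st nst x) => lem; [left|right]; apply: le_trans lem le_mkz.
  pose c : nat := `|ext_position (val s) 1%g|%N.
  have le_c : (`|ext_position (val s) 1%g| <= c%:Z)%R by rewrite /c abszE.
  have [[st nst]|triv] := pselect (val s != val t /\ ~~ adj (val s) (val t)).
    have [k Pk] := ext_position_nadj st nst.
    have le_ck : (c%:Z <= (k + c)%:Z)%R by rewrite lez_nat leq_addl.
    have le_k : (k%:Z <= (k + c)%:Z)%R by rewrite lez_nat leq_addr.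
    exists (k + c)%N; split=> [|_ _ x]; first exact: le_trans le_c le_ck.
    by case: (Pk x) => le; [left|right]; apply: le_trans le le_k.
  exists c; split=> // st nst.
  by case: triv.
have {boundN} boundN s t : P (s, t) N by apply: boundN; rewrite mem_enum.
exists (2 * N).+1 => // n phi n_neq0 phiE.
have phi_letter (s : induced_subgraph S) b : phi (letter (s, b)) =
    zpow (val (val s)) (sgn b * ((2 * N).+1%:Z * n s))%R.
  by rewrite -zpow_sgn -phiE; case: b; rewrite ?letter_false ?hom_V.
have pos_self (s : induced_subgraph S) b y : ext_position (val s) (phi (letter (s, b)) * y) =
    (sgn b * ((2 * N).+1%:Z * n s) + ext_position (val s) y)%R.
  by rewrite phi_letter (zpow_shift (@ext_position_self (val s))) mulr1.
have pos_adj (s t : induced_subgraph S) b y : adj (val s) (val t) ->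
    ext_position (val t) (phi (letter (s, b)) * y) = ext_position (val t) y.
  move=> st; rewrite phi_letter (@zpow_shift _ (ext_position (val t)) 0).
    by rewrite mulr0 add0r.
  by move=> z; rewrite ext_position_adj // add0r.
pose X (l : induced_subgraph S * bool) (y : raag G) := (N%:Z <
  orient (n l.1) l.2 * ext_position (val l.1) y)%R.
have X_self (s : induced_subgraph S) b y :
    (`|ext_position (val s) y| <= N%:Z)%R -> X (s, b) (phi (letter (s, b)) * y).
  rewrite /X /= pos_self => le_y.
  have [d [lt_d _ ge_y ->]] := orient_step N (ext_position (val s) y) b (n_neq0 s).
  have leN : (- N%:Z <= - `|ext_position (val s) y|)%R by rewrite lerN2.
  by have := le_trans leN ge_y; move: (orient _ _ * _)%R => z; lia.
apply: (@pingpong_injective _ _ phi X 1).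
- move=> [s b] y; rewrite /X /= pos_self.
  have [d [lt_d _ _ ->]] := orient_step N (ext_position (val s) y) b (n_neq0 s).
  by move: (orient _ _ * _)%R => z; lia.
- move=> [s b] [t e] y /= st nst Xt; apply: X_self.
  have ne_ts : val t != val s by rewrite val_eqE eq_sym.
  have nadj_ts : ~~ adj (val t) (val s) by rewrite adj_sym.
  have [_ /(_ ne_ts nadj_ts y)[]//] := boundN t s.
  have [d [_ le_y _ _]] := orient_step N (ext_position (val t) y) e (n_neq0 t).
  by move=> le_t; have := lt_le_trans Xt (le_trans le_y le_t); rewrite ltxx.
- by move=> [s b] [t e] y /= st; rewrite /X /= pos_adj.
- by move=> [s b]; apply: X_self; have [] := boundN s s.
- move=> [s b] Xs; have [/= le_s _] := boundN s s.
  have [d [_ le_y _ _]] := orient_step N (ext_position (val s) 1) b (n_neq0 s).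
  by have := lt_le_trans Xs (le_trans le_y le_s); rewrite ltxx.
Qed.

End Powers.

(** * Elements supported on a clique subgroup *)
Section Generated.
Variable A : groupType.
Implicit Types (S H : set A).

Lemma subgroup1 H : is_subgroup H -> H 1.
Proof. by case. Qed.

Lemma subgroupV H x : is_subgroup H -> H x -> H x^-1.
Proof. by case=> H1 Hdiv Hx; rewrite -div1g; apply: Hdiv. Qed.

Lemma subgroupM H x y : is_subgroup H -> H x -> H y -> H (x * y).
Proof.
move=> sH Hx Hy; rewrite -(invgK y); case: (sH) => _; apply=> //.
exact: subgroupV.
Qed.

Lemma subgroupX H x n : is_subgroup H -> H x -> H (zpow x n).
Proof.
move=> sH Hx; have HX k : H (x ^+ k).
  elim: k => [|k IHk]; first exact: subgroup1.
  by rewrite expgS; apply: subgroupM.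
by case: n => k; [apply: HX|apply: subgroupV => //; apply: HX].
Qed.

Lemma generated_subgroup S : is_subgroup (generated S).
Proof.
split=> [|x y Sx Sy] H [sH SH]; first exact: subgroup1.
by case: (sH) => _; apply; [apply: Sx|apply: Sy].
Qed.

Lemma sub_generated S x : S x -> generated S x.
Proof. by move=> Sx H [_]; apply. Qed.

Lemma generated_min S H : is_subgroup H -> (forall x, S x -> H x) ->
  forall x, generated S x -> H x.
Proof. by move=> sH SH x; apply. Qed.

Lemma conjugate_subgroup H g : is_subgroup H ->
  is_subgroup [set g * x * g^-1 | x in H]%classic.
Proof.
move=> sH; split=> [|_ _ [x Hx <-] [y Hy <-]].
  by exists 1; [exact: subgroup1 | rewrite mulg1 mulgV].
exists (x / y); first by case: (sH) => _; apply.
by rewrite !invgM invgK !mulgA mulgVK.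
Qed.

End Generated.

Lemma hom_prod (A B : groupType) (f : {multiplicative A -> B}) (I : Type)
    (r : seq I) (F : I -> A) :
  f (\prod_(i <- r) F i) = \prod_(i <- r) f (F i).
Proof. exact: (big_morph f (@gmulfM _ _ f) (hom_1 f)). Qed.

Section CommutingPowers.
Variables (A : groupType) (I : eqType) (r : seq I) (F : I -> A).
Hypothesis F_comm : forall i j, i \in r -> j \in r -> commute (F i) (F j).

Definition prod_zpow (n : I -> int) : A := \prod_(i <- r) zpow (F i) (n i).

Lemma zpow_commute i j m n : i \in r -> j \in r -> commute (zpow (F i) m) (zpow (F j) n).
Proof.
move=> ri rj; apply/commute_zpow/commute_sym/commute_zpow; exact: F_comm.
Qed.

Lemma prod_zpow_commute m n : commute (prod_zpow m) (prod_zpow n).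
Proof.
rewrite /prod_zpow [X in commute X _]big_seq [X in commute _ X]big_seq.
apply: commute_prod => j rj; apply/commute_sym.
by apply: commute_prod => i ri; apply: zpow_commute.
Qed.

Lemma prod_zpowD m n : prod_zpow (fun i => m i + n i)%R = prod_zpow m * prod_zpow n.
Proof.
rewrite /prod_zpow ![\prod_(i <- r) _]big_seq -prodgM_commute.
  by apply: eq_bigr => i _; rewrite zpowD.
by move=> i j ri rj; apply: zpow_commute.
Qed.

Lemma prod_zpow0 : prod_zpow (fun=> 0%R) = 1.
Proof. by rewrite /prod_zpow big1. Qed.

Lemma prod_zpowX n (k : nat) : prod_zpow n ^+ k = prod_zpow (fun i => k%:Z * n i)%R.
Proof.
elim: k => [|k IHk].
  by apply: esym; apply: big1 => i _; rewrite mul0r.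
rewrite expgS IHk -prod_zpowD; apply: eq_bigr => i _; congr zpow.
by rewrite -addn1 PoszD mulrDl mul1r addrC.
Qed.

Lemma prod_zpow_subgroup : is_subgroup [set x | exists n, x = prod_zpow n]%classic.
Proof.
split=> [|_ _ [m ->] [n ->]]; first by exists (fun=> 0%R); rewrite prod_zpow0.
exists (fun i => m i - n i)%R; rewrite (prod_zpowD m (fun i => - n i)%R); congr (_ * _).
by apply: mulg1_eq; rewrite -prod_zpowD /prod_zpow big1 // => i _; rewrite subrr.
Qed.

Lemma prod_zpow1 i : uniq r -> i \in r -> prod_zpow (fun j => Posz (j == i)) = F i.
Proof.
move=> + ri; rewrite /prod_zpow; case/splitPr: ri => r1 r2.
rewrite cat_uniq /= negb_or => /and3P[_ /andP[r1i _] /andP[r2i _]].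
have triv s : i \notin s -> \prod_(j <- s) zpow (F j) (Posz (j == i)) = 1.
  by move=> nsi; apply: big1_seq => j /andP[_ sj]; case: eqP sj nsi => // -> ->.
by rewrite big_cat big_cons /= !triv // eqxx /= mulg1 mul1g.
Qed.

End CommutingPowers.

Lemma clique_vertex_adj (H : sgraph) (K : clique_graph H) (s t : H) :
  s \in val K -> t \in val K -> s != t -> adj s t.
Proof.
have /andP[_ /asboolP cliqueK] := valP K.
by move=> Ks Kt; apply: (cliqueK s t Ks Kt).
Qed.

Section Support.
Variable G : sgraph.
Implicit Types (v w : G) (g h x : raag G) (T : set G).

Lemma special_generatedP T x :
  generated (@std_gen G @` T)%classic x <-> special (fun v => `[< T v >]) x.
Proof.
split=> [Tx|].
  apply: generated_min Tx => [|_ [v Tv <-]].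
    by split=> [|y z Ty Tz]; [exact: special1 | apply: specialM => //; apply: specialV].
  by apply: (@special_letter _ _ (v, true)); apply/asboolP.
have sT := generated_subgroup (@std_gen G @` T)%classic.
move: x; apply: (@special_ind _ _ (generated _)) => [|[v b] x /= /asboolP Tv Tx].
  exact: subgroup1.
apply: (subgroupM sT) => //.
have Tgen : generated (@std_gen G @` T)%classic (std_gen v).
  by apply: sub_generated; exists v.
by case: b; rewrite ?letter_false //; apply: (subgroupV sT).
Qed.

Lemma special_std_gen (S : pred G) v : special S (std_gen v) -> S v.
Proof.
move=> /retr_id; rewrite retr_gen; case: ifP => // _ e.
by have := std_gen_neq1 v; rewrite -e eqxx.
Qed.

(** Apply the retraction onto the special subgroup: it fixes the conjugate, and
    conjugation is trivial in its image. *)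
Lemma abelian_special_conjugate (S : pred G) h v :
  (forall x y, special S x -> special S y -> commute x y) ->
  special S (conj_gen h v) -> S v /\ conj_gen h v = std_gen v.
Proof.
move=> abS Sx; have := retr_id Sx.
rewrite [in LHS]/conj_gen !gmulfM hom_V retr_gen; case: ifP => Sv.
  move=> <-; split=> //; have Sgen : special S (std_gen v).
    exact: (@special_letter _ _ (v, true)).
  by rewrite (abS _ _ (special_retr S h) Sgen) mulgK.
rewrite mulg1 mulgV => e; have /eqP[] := std_gen_neq1 v.
by apply: (mulgI h); apply: (mulIg h^-1); rewrite mulg1 mulgV e.
Qed.

Variable K : clique_graph (ext_graph G).
Let r : seq (ext_graph G) := val K.

Lemma clique_commute s t : s \in r -> t \in r -> commute (val s) (val t).
Proof.
move=> rs rt; have [->|st] := eqVneq s t; first exact: commute_refl.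
by have /ext_adjP[] := clique_vertex_adj rs rt st.
Qed.

Lemma clique_subgroupP x : clique_subgroup K x ->
  exists n, x = prod_zpow r (fun s => val s) n.
Proof.
pose H := [set y | exists n, y = prod_zpow r (fun s => val s) n]%classic.
move=> Kx; apply: (generated_min (H := H) _ _ Kx) => [|_ [s rs <-]].
  exact/prod_zpow_subgroup/clique_commute.
exists (fun t => Posz (t == s)); rewrite prod_zpow1 //; apply: fset_uniq.
Qed.

Lemma mem_clique_subgroup s : s \in r -> clique_subgroup K (val s).
Proof. by move=> rs; apply: sub_generated; exists s. Qed.

(** P_K is a conjugate g A(T) g^-1, and it is abelian, so each vertex of K is
    g v g^-1 for some v in T.  If the exponent of s were zero, x would lie in
    the parabolic subgroup generated by the other vertices, which does not
    contain s. *)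
Lemma supp_clique_powers x : has_supp x (clique_subgroup K) ->
  exists2 n, forall s, s \in r -> n s != 0%R & x = prod_zpow r (fun s => val s) n.
Proof.
case=> -[T [g def_P]] Px min_P; have [n def_x] := clique_subgroupP Px.
exists n => // s rs; apply/eqP => ns0.
have inP y : clique_subgroup K y <-> special (fun v => `[< T v >]) (g^-1 * y * g).
  rewrite def_P -special_generatedP; split=> [[z Tz <-]|Ty].
    by rewrite !mulgA mulVg mul1g mulgVK.
  by exists (g^-1 * y * g) => //; rewrite !mulgA mulgV mul1g mulgK.
have abT y z : special (fun v => `[< T v >]) y -> special (fun v => `[< T v >]) z ->
    commute y z.
  have lift t : special (fun v => `[< T v >]) t -> clique_subgroup K (g * t * g^-1).
    by move=> Tt; apply/inP; rewrite !mulgA mulVg mul1g mulgVK.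
  move=> /lift/clique_subgroupP[m def_y] /lift/clique_subgroupP[k def_z].
  have := prod_zpow_commute clique_commute m k; rewrite -def_y -def_z /commute.
  by rewrite !mulgA !mulgVK => /mulIg; rewrite -!(mulgA g) => /mulgI.
have std t : t \in r -> exists v, val t = conj_gen g v.
  move=> /mem_clique_subgroup/inP; rewrite ext_valE.
  set h := ext_base t; set v := ext_label t => Tt; exists v.
  have def_c : g^-1 * conj_gen h v * g = conj_gen (g^-1 * h) v.
    by rewrite /conj_gen invgM invgK !mulgA.
  rewrite def_c in Tt; have [_ eq_v] := abelian_special_conjugate abT Tt.
  by rewrite /(conj_gen g v) -eq_v -def_c !mulgA mulgV mul1g mulgK.
(* The parabolic subgroup of the clique without s. *)
pose T' : set G := [set v | exists t, [/\ t \in r, t != s & val t = conj_gen g v]]%classic.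
pose Q : set (raag G) := [set g * y * g^-1 | y in generated (@std_gen G @` T')]%classic.
have sQ : is_subgroup Q by apply/conjugate_subgroup/generated_subgroup.
have Qx : Q x.
  rewrite def_x /prod_zpow big_seq; apply: big_ind => [|y z Qy Qz|t rt].
  - exact: subgroup1.
  - exact: subgroupM.
  have [->|ts] := eqVneq t s; first by rewrite ns0; apply: subgroup1.
  have [v def_t] := std t rt; apply: subgroupX => //.
  exists (std_gen v); last by rewrite def_t.
  by apply: sub_generated; exists v => //; exists t.
have PQ : (clique_subgroup K `<=` Q)%classic.
  by apply: min_P => //; exists T', g.
have [y /special_generatedP Ty def_s] := PQ _ (mem_clique_subgroup rs).
have [v def_v] := std s rs.
have yE : y = std_gen v.
  apply: (mulgI g); apply: (mulIg g^-1); rewrite def_s def_v //.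
have /asboolP[t [_ /eqP ts def_t]] : `[< T' v >].
  by apply: (@special_std_gen (fun v => `[< T' v >])); rewrite -yE.
by apply: ts; apply: val_inj; rewrite def_t -def_v.
Qed.

End Support.

(** * Assembling the embedding *)
Section Main.
Variables (G : sgraph) (D : {fset clique_graph (ext_graph G)}).

Definition clique_union : {fset ext_graph G} :=
  (\bigcup_(K <- enum_fset D) val K)%fset.

Lemma clique_union_mem K s : K \in D -> s \in val K -> s \in clique_union.
Proof.
by move=> DK Ks; apply/bigfcupP; exists K; rewrite ?andbT.
Qed.

Lemma clique_unionP s : s \in clique_union -> exists K : D, s \in val (val K).
Proof.
move=> /bigfcupP[K]; rewrite andbT => DK Ks.
by exists [` DK]%fset.
Qed.

Definition clique_members (K : induced_subgraph D) : seq (induced_subgraph clique_union) :=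
  pmap insub (enum_fset (val (val K))).

Lemma val_clique_members K : [seq val s | s <- clique_members K] = enum_fset (val (val K)).
Proof.
rewrite pmap_filter; last exact: insubK.
apply/all_filterP/allP => s Ks; rewrite isSome_insub.
exact: clique_union_mem (valP K) Ks.
Qed.

Lemma mem_clique_members K s : (s \in clique_members K) = (val s \in val (val K)).
Proof.
by rewrite -(mem_map val_inj) val_clique_members.
Qed.

Hypothesis hD : forall K L : clique_graph (ext_graph G), K \in D -> L \in D ->
  K != L -> [disjoint (val K) & (val L)]%fset.

Lemma clique_disjoint (K L : induced_subgraph D) s : K != L ->
  s \in val (val K) -> s \notin val (val L).
Proof.
rewrite -(inj_eq val_inj) => KL Ks.
by have /fdisjointP := hD (valP K) (valP L) KL; apply.
Qed.

Lemma clique_members_family : clique_family clique_members.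
Proof.
split.
- move=> K; rewrite -size_eq0 -(size_map val) val_clique_members size_eq0.
  have /andP[+ _] := valP (val K); apply: contraNneq => K0.
  apply/eqP/fsetP => s.
  by rewrite -[LHS]/(s \in enum_fset (val (val K))) K0 in_fset0.
- by move=> K; rewrite -(map_inj_uniq val_inj) val_clique_members; apply: fset_uniq.
- move=> K s t; rewrite !mem_clique_members => Ks Kt st.
  have st' : val s != val t by rewrite (inj_eq val_inj).
  exact: clique_vertex_adj Ks Kt st'.
- move=> K L s; rewrite !mem_clique_members => Ks Ls.
  apply: contrapT => /eqP KL.
  by move: (clique_disjoint KL Ks); rewrite Ls.
Qed.

Lemma induced_clique_adj (K L : induced_subgraph D) :
  adj K L = family_adj clique_members K L.
Proof.
rewrite /family_adj; have [->|KL] := eqVneq K L; first by rewrite adj_irrefl.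
apply/andP/allrelP => [[_ /asboolP[C [cliqueC KC LC]]] s t|KLadj].
  rewrite !mem_clique_members => Ks Lt; apply: cliqueC; [exact: KC|exact: LC|].
  by apply: contraNneq (clique_disjoint KL Ks) => ->.
split; first by rewrite (inj_eq val_inj).
apply/asboolP; exists [set s | s \in val (val K) \/ s \in val (val L)]%classic.
split=> [s t|s Ks|s Ls]; [|by left|by right].
have across u v : u \in val (val K) -> v \in val (val L) -> adj u v.
  move=> Ku Lv.
  have := KLadj [` clique_union_mem (valP K) Ku]%fset [` clique_union_mem (valP L) Lv]%fset.
  by rewrite !mem_clique_members; apply.
case=> [Ks|Ls] [Kt|Lt] st.
- exact: clique_vertex_adj Ks Kt st.
- exact: across Ks Lt.
- by rewrite adj_sym; exact: across Kt Ls.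
- exact: clique_vertex_adj Ls Lt st.
Qed.

End Main.

Theorem theorem1p6 (G : sgraph) (hG : ~ has_induced_square G)
    (D : {fset clique_graph (ext_graph G)})
    (hD : forall K L : clique_graph (ext_graph G), K \in D -> L \in D ->
            K != L -> [disjoint (val K) & (val L)]%fset) :
  exists M : nat, 0 < M /\
    forall g : induced_subgraph D -> raag G,
      (forall K : induced_subgraph D, has_supp (g K) (clique_subgroup (val K))) ->
      exists phi : {multiplicative raag (induced_subgraph D) -> raag G},
        injective phi /\
        forall K : induced_subgraph D, phi (std_gen K) = g K ^+ M.
Proof.
have [M M_gt0 powM] := powers_injective (clique_union D).
exists M; split=> // g supp_g.
have /choice[n nP] : forall K : induced_subgraph D, exists n : ext_graph G -> int,
    (forall s, s \in val (val K) -> n s != 0%R) /\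
    g K = prod_zpow (enum_fset (val (val K))) (fun s => val s) n.
  by move=> K; have [n n0 gK] := supp_clique_powers (supp_g K); exists n.
have famK := clique_members_family hD.
have /choice[home homeP] : forall s : induced_subgraph (clique_union D),
    exists K : induced_subgraph D, val s \in val (val K).
  by move=> s; have [K] := clique_unionP (valP s); exists K.
pose m (s : induced_subgraph (clique_union D)) : int := n (home s) (val s).
have [phi1 phi1E] : exists phi1 : {multiplicative
      raag (induced_subgraph (clique_union D)) -> raag G},
    forall s, phi1 (std_gen s) = zpow (val (val s)) (M%:Z * m s)%R.
  apply: raag_hom_exists => s t st; have /ext_adjP[_ cst] : adj (val s) (val t) by [].
  exact/commute_zpow/commute_sym/commute_zpow/commute_sym.
have phi1_inj : injective phi1 by apply: powM phi1E => s; apply: (nP (home s)).1.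
have [phi2 phi2E] : exists phi2 : {multiplicative raag (induced_subgraph D) ->
      raag (induced_subgraph (clique_union D))},
    forall K, phi2 (std_gen K) = clique_prod (clique_members K).
  apply: raag_hom_exists => K L; rewrite (induced_clique_adj hD) => /andP[_].
  exact: clique_prod_commute.
have phi2_inj : injective phi2.
  have sqf : ~ has_induced_square (induced_subgraph (clique_union D)).
    exact/induced_square_free/ext_square_free.
  apply: (clique_family_injective sqf (K := @clique_members G D)
            (e := enum {: D}) famK (induced_clique_adj hD) _ phi2E).
  by move=> K; rewrite mem_enum.
exists (phi1 \o phi2); split=> [|K /=]; first exact: inj_comp.
have [_ ->] := nP K; rewrite prod_zpowX; last exact: clique_commute.
rewrite phi2E /clique_prod hom_prod /prod_zpow -val_clique_members big_map.
rewrite big_seq [RHS]big_seq; apply: eq_bigr => s Ks; rewrite phi1E /m.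
rewrite (_ : home s = K) //; apply: (family_disjoint famK (x := s)) => //.
by rewrite mem_clique_members.
Qed.
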